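(* There exist a real analytic almost complex structure $J$ on $\mathbb{R}^6$, a real analytic hypersurface $M=\{\varphi=0\}\subset\mathbb{R}^6$ with $0\in M$ such that $\ker\mathcal{L}$ is a subbundle of (complex) dimension $1$ of $T^JM$, and a vector $v\in(\ker\mathcal{L})_0$ such that no $J$-holomorphic disc $\gamma$ satisfying $\gamma(0)=0$ and $\frac{\partial\gamma}{\partial x}(0)=v$ is tangent to $M$ at $0$ at order greater than $5$.
   Context: A real analytic hypersurface is $M=\{z\in\mathbb{R}^{2n}:\varphi(z)=0\}$ with $\varphi$ real valued, real analytic, and $d\varphi$ nowhere vanishing on $M$. An almost complex structure $J$ is a field of linear endomorphisms of the tangent spaces with $J^2=-\mathrm{Id}$. $T^JM=TM\cap J\,TM$ is the $J$-invariant part of $TM$. The Levi form of $M$ is $\mathcal{L}_\varphi(X)=d\varphi(J[X,JX])$ for vector fields $X\in T^JM$ (sections of $T^JM$). Its polar form is $\hat{\mathcal{L}}_\varphi(X,Y)=d\varphi(J[X,JY]+J[Y,JX])+i\,d\varphi(J[X,Y]+J[JX,JY])$ for $X,Y\in T^JM$. Both depend only on the pointwise values of $X,Y$. $\ker\mathcal{L}$ is the kernel of this form: at $p\in M$, $(\ker\mathcal{L})_p=\{X\in T^J_pM:\hat{\mathcal{L}}_\varphi(X,Y)=0\ \forall\, Y\in T^J_pM\}$. It does not depend on the choice of $\varphi$. $\mathbb{D}\subset\mathbb{C}$ is the unit disc with its standard structure $J_0$ and coordinate $\zeta=x+iy$. A $J$-holomorphic disc is a $C^1$ map $\gamma:\mathbb{D}\to\mathbb{R}^{2n}$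 with $d\gamma(\zeta)\circ J_0=J(\gamma(\zeta))\circ d\gamma(\zeta)$ for all $\zeta\in\mathbb{D}$. A disc $\gamma$ with $\gamma(0)=0$ is tangent to $M$ at $0$ at order $k$ if $\varphi\circ\gamma(\zeta)=O(|\zeta|^k)$ as $\zeta\to0$. *)

(* Defs.v *)
From HB Require Import structures.
From mathcomp Require Import all_boot all_order all_algebra.
From mathcomp Require Import complex.
From mathcomp Require Import all_classical all_reals all_analysis.
Set Implicit Arguments.
Unset Strict Implicit.
Unset Printing Implicit Defensive.
Import Order.TTheory GRing.Theory Num.Theory.
Import numFieldNormedType.Exports.
Local Open Scope classical_set_scope.
Local Open Scope ring_scope.

Section Analytic.
Context {R : realType} {d : nat}.
Implicit Types (a x : 'cV[R]_d).

Definition power_term (c : {ffun 'I_d -> nat} -> R) a x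
    (k : {ffun 'I_d -> nat}) : \bar R :=
  (c k * \prod_i (x i 0 - a i 0) ^+ k i)%:E.

(** The family of terms is absolutely summable near [a]; as [esum] is only
    meaningful for nonnegative families, the value of the sum is the
    difference of the sums of the positive and of the negative parts. *)
Definition analytic_at (f : 'cV[R]_d -> R) a : Prop :=
  exists c : {ffun 'I_d -> nat} -> R, \forall x \near a,
    summable setT (power_term c a x) /\
    (f x)%:E = (\esum_(k in setT) (power_term c a x)^\+ k
                - \esum_(k in setT) (power_term c a x)^\- k)%E.

Definition analytic_mx_at m n (F : 'cV[R]_d -> 'M[R]_(m, n)) a : Prop :=
  forall i j, analytic_at (fun x => F x i j) a.

End Analytic.

Definition C1_on {R : realType} {V W : normedModType R} (U : set V)
    (f : V -> W) : Prop :=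
  forall p, U p -> differentiable f p /\
    forall v, {for p, continuous (fun q => 'd f q v)}.

Section AlmostComplex.
Context {R : realType} {d : nat}.
Local Notation V := 'cV[R]_d.
Implicit Types (J : V -> 'M[R]_d) (phi : V -> R) (X Y : V -> V) (p : V).

(** The endomorphism of the tangent space at [p] is [v |-> J p *m v]. *)
Definition analytic_almost_complex J : Prop :=
  forall p, J p *m J p = - 1%:M /\ analytic_mx_at J p.

Definition zeros phi : set V := [set p | phi p = 0].

Definition analytic_hypersurface phi : Prop :=
  (forall p, analytic_at phi p) /\
  forall p, zeros phi p -> exists v, 'd phi p v != 0.

Definition tangent phi p : set V := [set v | 'd phi p v = 0].

Definition Jtangent J phi p : set V :=
  tangent phi p `&` [set J p *m v | v in tangent phi p].

Definition bracket X Y p : V := 'd Y p (X p) - 'd X p (Y p).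

Definition Jfield J X : V -> V := fun p => J p *m X p.

Definition levi_polar J phi X Y p : R[i] :=
  Complex
    ('d phi p (J p *m bracket X (Jfield J Y) p
               + J p *m bracket Y (Jfield J X) p))
    ('d phi p (J p *m bracket X Y p
               + J p *m bracket (Jfield J X) (Jfield J Y) p)).

(** Germs at [p] of vector fields whose restriction to the hypersurface is a
    section of the J-invariant tangent bundle. For [p] on the hypersurface,
    [levi_polar J phi X Y p] depends only on [X p] and [Y p] when [X], [Y] are
    such fields, in particular not on how they extend off the hypersurface. *)
Definition Jsection_at J phi p X : Prop :=
  exists U : set V, [/\ open U, U p, C1_on U X &
    forall q, U q -> zeros phi q -> Jtangent J phi q (X q)].

Definition levi_ker J phi p : set V :=
  [set v | Jtangent J phi p v /\
    forall X Y, Jsection_at J phi p X -> Jsection_at J phi p Y ->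
      X p = v -> levi_polar J phi X Y p = 0].

(** Local frames are real analytic: the base and the bundle of which [K] is a
    subbundle are real analytic. *)
Definition complex_line_subbundle J phi (K : V -> set V) : Prop :=
  forall p, zeros phi p -> exists (U : set V) (e : V -> V),
    [/\ open U, U p, forall q, U q -> analytic_mx_at e q &
      forall q, U q -> zeros phi q ->
        [/\ K q `<=` Jtangent J phi q, e q != 0 &
          K q = [set v | exists a b : R,
                   v = a *: e q + b *: (J q *m e q)]]].

(** The complex plane is [R * R], [(x, y)] standing for [x + i y]; since the
    norm of [R * R] is the sup norm, the modulus is spelled out. *)
Definition modulus (z : R * R) : R := Num.sqrt (z.1 ^+ 2 + z.2 ^+ 2).

Definition unit_disc : set (R * R) := [set z | modulus z < 1].

Definition J0 (z : R * R) : R * R := (- z.2, z.1).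

(** Discs are total functions of which only the values on [unit_disc] matter. *)
Definition Jholomorphic_disc J (g : R * R -> V) : Prop :=
  C1_on unit_disc g /\
  forall z, unit_disc z -> forall w, 'd g z (J0 w) = J (g z) *m 'd g z w.

Definition tangent_at_order phi (g : R * R -> V) (k : nat) : Prop :=
  (phi \o g) =O_ (0 : R * R) (fun z => modulus z ^+ k).

End AlmostComplex.

(* Main.v *)
(* With [P = |z1|^4 / 8 + |z2|^2 / 2 - |z1|^2 * Re z2], let the (1,0)-forms of
   [J] be spanned by [dz1], [dz2] and [dw + dbar P + z1 * conj z2 * d(conj z1)],
   and let [M = {Re w = 0}]. On the complex tangent space, which projects
   isomorphically onto the [(dz1, dz2)]-plane, the Levi form is a multiple of
   [|b - conj z1 * a|^2] at [(a, b)], so its kernel is the line spanned by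
   [(1, conj z1)]; take [v = (1, 0)] at the origin.

   Along a disc, [z1 = f] and [z2 = g] are holomorphic with [f = zeta + o(zeta)]
   and [g = o(zeta)], and [K = w + P(f, g)] satisfies
   [dbar K = - f * conj g * conj f'], where [f * conj f'] is close to [zeta]. So
   the derivative of the mean [A(Re K)(r)] over the circle of radius [r] is
   [- 2 r A(Re g) + o(r) A(|g|) = o(r) A(|g|)], whereas
   [A(Re K) = A(Re w) + A(P)] and [A(P) >= c r^4 + c' A(|g|^2)]. If
   [Re w = O(r^6)], comparing the two first forces [A(|g|^2)] to vanish and then
   contradicts the term [c r^4]. Only first derivatives are used, so no
   regularity theory of discs is needed. *)
Require Import Defs.
From HB Require Import structures.
From mathcomp Require Import all_boot all_order all_algebra.
From mathcomp Require Import complex.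
From mathcomp Require Import all_classical all_reals all_analysis.
From mathcomp Require Import ring lra.
Set Implicit Arguments.
Unset Strict Implicit.
Unset Printing Implicit Defensive.
Import Order.TTheory GRing.Theory Num.Theory.
Import numFieldNormedType.Exports.
Local Open Scope classical_set_scope.
Local Open Scope ring_scope.

(** * Polynomial functions *)

Lemma esum_finite_support (R : realType) (T : choiceType) (s : seq T)
    (a : T -> \bar R) : uniq s -> (forall k, (0 <= a k)%E) ->
    (forall k, k \notin s -> a k = 0%E) ->
  (\esum_(k in setT) a k = \sum_(k <- s) a k)%E.
Proof.
move=> us a0 sa; rewrite fsbig_seq// -esum_fset//.
rewrite [RHS]esum_mkcond; apply: eq_esum => k _.
case: ifPn => // /negP ks; apply: sa; apply/negP => ks'; apply: ks.
by rewrite inE.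
Qed.

(** A closure property of functions rather than a syntax: analyticity and differentiability follow
    by induction, and concrete entries are recognised by applying constructors. *)
Inductive polynomial_fun (R : realType) (d : nat) : ('cV[R]_d -> R) -> Prop :=
| poly_cst c : polynomial_fun (fun=> c)
| poly_coord i : polynomial_fun (fun x => x i 0)
| poly_add f g : polynomial_fun f -> polynomial_fun g ->
    polynomial_fun (fun x => f x + g x)
| poly_mul f g : polynomial_fun f -> polynomial_fun g ->
    polynomial_fun (fun x => f x * g x).

Arguments poly_cst {R d} c.
Arguments poly_coord {R d} i.

Section PolynomialFun.
Context {R : realType} {d : nat}.
Local Notation V := 'cV[R]_d.
Local Notation exponent := {ffun 'I_d -> nat}.
Implicit Types (f g : V -> R) (a p v : V).

Lemma poly_opp f : polynomial_fun f -> polynomial_fun (fun x => - f x).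
Proof.
move=> pf; under eq_fun do rewrite -mulN1r.
exact: poly_mul (poly_cst _) pf.
Qed.

Lemma poly_sub f g : polynomial_fun f -> polynomial_fun g ->
  polynomial_fun (fun x => f x - g x).
Proof. by move=> pf pg; apply: poly_add pf (poly_opp pg). Qed.

Lemma poly_sum n (F : 'I_n -> V -> R) : (forall i, polynomial_fun (F i)) ->
  polynomial_fun (fun x => \sum_i F i x).
Proof.
elim: n F => [|n IH] F pF.
  by under eq_fun do rewrite big_ord0; exact: poly_cst.
under eq_fun do rewrite big_ord_recl.
by apply: poly_add => //; apply: IH => i; exact: pF.
Qed.

Definition monomial_at a (x : V) (k : exponent) : R :=
  \prod_i (x i 0 - a i 0) ^+ k i.

(** Recentring at [a]: a coordinate is [a i 0] plus its increment, and exponents add under products.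
    An exponent may occur several times in [s]. *)
Lemma poly_expand f : polynomial_fun f -> forall a,
  exists s : seq (exponent * R),
    forall x, f x = \sum_(m <- s) m.2 * monomial_at a x m.1.
Proof.
elim=> {f} [c|i|f g _ IHf _ IHg|f g _ IHf _ IHg] a.
- exists [:: ([ffun=> 0%N], c)] => x; rewrite big_seq1 /monomial_at big1 ?mulr1//.
  by move=> j _; rewrite ffunE expr0.
- exists [:: ([ffun=> 0%N], a i 0); ([ffun j => (j == i) : nat], 1)] => x.
  rewrite big_cons big_seq1 /= /monomial_at big1 ?mulr1 ?mul1r; last first.
    by move=> j _; rewrite ffunE expr0.
  rewrite (bigD1 i)//= ffunE eqxx expr1 big1 ?mulr1 1?addrC ?subrK// => j ji.
  by rewrite ffunE (negPf ji) expr0.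
- have [[s Hs] [t Ht]] := (IHf a, IHg a); exists (s ++ t) => x.
  by rewrite big_cat/= -Hs -Ht.
- have [[s Hs] [t Ht]] := (IHf a, IHg a).
  exists [seq ([ffun i => (m.1 i + n.1 i)%N] : exponent, m.2 * n.2)
         | m : exponent * R <- s, n : exponent * R <- t] => x.
  rewrite big_allpairs_dep/= Hs Ht big_distrl/=; apply: eq_bigr => m _.
  rewrite big_distrr/=; apply: eq_bigr => n _.
  rewrite [RHS](_ : _ = m.2 * n.2 * (monomial_at a x m.1 * monomial_at a x n.1)).
    by rewrite mulrACA.
  congr (_ * _); rewrite /monomial_at -big_split/=; apply: eq_bigr => i _.
  by rewrite ffunE exprD.
Qed.

Lemma poly_analytic f : polynomial_fun f -> forall a, analytic_at f a.
Proof.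
move=> pf a; have [s Hs] := poly_expand pf a.
(* Repeated exponents are merged, since [analytic_at] wants one coefficient per exponent. *)
pose c (k : exponent) := \sum_(m <- s | m.1 == k) m.2.
exists c; apply: filterE => x.
pose r := undup [seq m.1 | m <- s].
have ur : uniq r by exact: undup_uniq.
have c0 k : k \notin r -> power_term c a x k = 0%E.
  rewrite mem_undup => kr; rewrite /power_term /c big1_seq ?mul0r// => m.
  by case/andP=> /eqP mk ms; case/negP: kr; rewrite -mk map_f.
have Ef : f x = \sum_(k <- r) c k * monomial_at a x k.
  rewrite Hs /c; under [RHS]eq_bigr do rewrite big_distrl/= big_mkcond.
  rewrite exchange_big/=; apply: eq_big_seq => m ms.
  rewrite (bigD1_seq m.1) ?mem_undup ?map_f//= eqxx big1 ?addr0// => k km.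
  by rewrite eq_sym (negPf km).
split.
  rewrite /summable (esum_finite_support ur) => [|k|k kr]; first last.
  - by rewrite c0// abse0.
  - exact: abse_ge0.
  - by apply: lte_sum_pinfty => k _; rewrite /power_term ltry.
rewrite !(esum_finite_support ur) => [|k|k kr|k|k kr]; first last.
- by rewrite funeposE c0 // maxxx.
- exact: funepos_ge0.
- by rewrite funenegE c0 // oppe0 maxxx.
- exact: funeneg_ge0.
under eq_bigr do rewrite funeposE /power_term -EFin_max.
under [X in (_ - X)%E]eq_bigr do rewrite funenegE /power_term -EFinN -EFin_max.
rewrite !sumEFin -EFinB -sumrB Ef; congr _%:E; apply: eq_bigr => k _.
rewrite -/(monomial_at a x k); set y := c k * _.
(* Each term is its positive part minus its negative part. *)
by rewrite /Num.max; case: ltP => ?; case: ltP => ?; lra.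
Qed.

End PolynomialFun.

(** * Differential calculus of entries and of polynomial fields *)

Section Differential.
Context {R : realType} {U : normedModType R}.

Lemma diff_entry m n (M : 'M[R]_(m, n)) i j (v : 'M[R]_(m, n)) :
  'd (fun N : 'M[R]_(m, n) => N i j : R) M v = v i j.
Proof.
have @f : {linear 'M[R]_(m, n) -> R}.
  by exists (fun N : 'M[R]_(_, _) => N i j); do 2![eexists]; do ?[constructor];
     rewrite ?mxE// => ? *; rewrite ?mxE//; move=> ?; rewrite !mxE.
rewrite (_ : (fun _ => _) = f) // diff_lin //.
exact: coord_continuous.
Qed.

Lemma differentiable_entry n (F : U -> 'cV[R]_n) p i :
  differentiable F p -> differentiable (fun x => F x i 0) p.
Proof.
move=> dF; apply: (@differentiable_comp _ _ _ _ F (fun N : 'cV[R]_n => N i 0)) => //.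
exact: differentiable_coord.
Qed.

Lemma diff_entry_comp n (F : U -> 'cV[R]_n) p i v : differentiable F p ->
  'd (fun x => F x i 0) p v = 'd F p v i 0.
Proof.
move=> dF; rewrite -(@diff_entry _ _ (F p)).
rewrite (_ : (fun x => F x i 0) = (fun N : 'cV[R]_n => N i 0 : R) \o F)//.
by rewrite diff_comp//; exact: differentiable_coord.
Qed.

Lemma differentiable_cV n (F : U -> 'cV[R]_n) p :
  (forall i, differentiable (fun x => F x i 0) p) -> differentiable F p.
Proof.
move=> dF; rewrite (_ : F = \sum_i (fun x => F x i 0 *: delta_mx i 0)).
  by apply: differentiable_sum => i; exact: differentiableZl.
apply/funext => x; rewrite fct_sumE [LHS]matrix_sum_delta.
by apply: eq_bigr => i _; rewrite big_ord1.
Qed.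

Lemma diffD_apply (f g : U -> R) p v : differentiable f p -> differentiable g p ->
  'd (fun x => f x + g x) p v = 'd f p v + 'd g p v.
Proof. by move=> df dg; rewrite [LHS](_ : _ = 'd (f + g) p v)// diffD. Qed.

Lemma diffM_apply (f g : U -> R) p v : differentiable f p -> differentiable g p ->
  'd (fun x => f x * g x) p v = f p * 'd g p v + g p * 'd f p v.
Proof. by move=> df dg; rewrite [LHS](_ : _ = 'd (f * g) p v)// diffM. Qed.

End Differential.

Section PolynomialDiff.
Context {R : realType} {d : nat}.
Local Notation V := 'cV[R]_d.
Implicit Types (f g : V -> R) (p v : V).

(** For fixed [v] the directional derivative is again polynomial; this is what makes polynomial
    fields continuously differentiable. *)
Lemma poly_diff f : polynomial_fun f -> (forall p, differentiable f p) /\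
  forall v, exists2 g, polynomial_fun g & forall p, 'd f p v = g p.
Proof.
elim=> {f} [c|i|f g pf [df Df] pg [dg Dg]|f g pf [df Df] pg [dg Dg]].
- split=> [p|v]; first exact: differentiable_cst.
  by exists (fun=> 0) => [|p]; [exact: poly_cst|rewrite diff_cst].
- split=> [p|v]; first exact: differentiable_coord.
  by exists (fun=> v i 0) => [|p]; [exact: poly_cst|rewrite diff_entry].
- split=> [p|v]; first exact: differentiableD.
  have [[f' pf' Df'] [g' pg' Dg']] := (Df v, Dg v).
  exists (fun x => f' x + g' x) => [|p]; first exact: poly_add.
  by rewrite diffD_apply// Df' Dg'.
- split=> [p|v]; first exact: differentiableM.
  have [[f' pf' Df'] [g' pg' Dg']] := (Df v, Dg v).
  exists (fun x => f x * g' x + g x * f' x) => [|p].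
    by apply: poly_add; exact: poly_mul.
  by rewrite diffM_apply// Df' Dg'.
Qed.

Lemma poly_differentiable f p : polynomial_fun f -> differentiable f p.
Proof. by move=> /poly_diff[]. Qed.

Lemma poly_field_C1 n (F : V -> 'cV[R]_n) :
  (forall i, polynomial_fun (fun x => F x i 0)) -> C1_on setT F.
Proof.
move=> pF p _.
have dF q : differentiable F q.
  by apply: differentiable_cV => i; exact: poly_differentiable.
split=> // v.
rewrite (_ : (fun q => 'd F q v) =
    \sum_i (fun q => 'd (fun x => F x i 0) q v *: delta_mx i 0)); last first.
  apply/funext => q; rewrite fct_sumE [LHS]matrix_sum_delta.
  by apply: eq_bigr => i _; rewrite big_ord1 diff_entry_comp.
apply: differentiable_continuous; apply: differentiable_sum => i.
apply: differentiableZl.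
have [_ /(_ v)[g pg Dg]] := poly_diff (pF i).
by under eq_fun do rewrite Dg; exact: poly_differentiable.
Qed.

End PolynomialDiff.
(** * Levi form of a coordinate hyperplane *)

Section LeviOfCoordinate.
Context {R : realType} {d : nat}.
Local Notation V := 'cV[R]_d.
Implicit Types (J : V -> 'M[R]_d) (X Y Z : V -> V) (p q u v w : V) (i : 'I_d).

(** The points [e *: u + p] stay in the hyperplane, so the difference quotients of [h] along them
    vanish for small [e]. *)
Lemma diff_vanishing (h : V -> R) i p u : differentiable h p ->
  (\forall q \near p, zeros (fun x : V => x i 0) q -> h q = 0) ->
  p i 0 = 0 -> u i 0 = 0 -> 'd h p u = 0.
Proof.
move=> dh h0 p0 u0; rewrite -deriveE//.
apply/cvg_lim => //; apply: cvg_near_cst.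
have cp : e *: u + p @[e --> (0 : R)] --> p.
  rewrite -[X in _ --> X]add0r -(scale0r u).
  apply: cvgD; last exact: cvg_cst.
  by apply: cvgZr_tmp; exact: cvg_id.
have hp : h p = 0 by exact: (nbhs_singleton h0).
near=> e; rewrite /= hp subr0.
have -> : h (e *: u + p) = 0.
  have : zeros (fun x : V => x i 0) (e *: u + p).
    by rewrite /zeros/= !mxE u0 p0 mulr0 addr0.
  near: e; apply: nbhs_dnbhs; exact: (cp _ h0).
by rewrite scaler0.
Unshelve. all: by end_near.
Qed.

(** The [i]-th component of [(D_u J) w] at [p], with [w] held constant. *)
Definition drow J i p u w : R := \sum_j 'd (fun q => J q i j) p u * w j 0.

Lemma drow_eq (D : 'I_d -> R) J i p u w :
  (forall j, 'd (fun q => J q i j) p u = D j) ->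
  drow J i p u w = \sum_j D j * w j 0.
Proof. by move=> dJ; apply: eq_bigr => j _; rewrite dJ. Qed.

(* Differentiating [(J X)_i = 0] along the hyperplane trades the derivative of
   [X] for that of [J]: this is what makes the Levi form tensorial. *)
Lemma mulmx_diff_section J i p X u :
  (forall j, differentiable (fun q => J q i j) p) -> differentiable X p ->
  (\forall q \near p, zeros (fun x : V => x i 0) q -> (J q *m X q) i 0 = 0) ->
  p i 0 = 0 -> u i 0 = 0 ->
  (J p *m 'd X p u) i 0 = - drow J i p u (X p).
Proof.
move=> dJ dX JX0 p0 u0; apply/eqP; rewrite -addr_eq0; apply/eqP.
have dXj j : differentiable (fun q => X q j 0) p by exact: differentiable_entry.
have dJX j : differentiable (fun q => J q i j * X q j 0) p.
  exact: differentiableM.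
have E : (fun q => (J q *m X q) i 0) = \sum_j (fun q => J q i j * X q j 0).
  by apply/funext => q; rewrite fct_sumE mxE.
have <- : 'd (fun q => (J q *m X q) i 0) p u = 0.
  by apply: (diff_vanishing (i := i)) => //; rewrite E; exact: differentiable_sum.
have dE : differentiable (fun q => (J q *m X q) i 0) p.
  by rewrite E; exact: differentiable_sum.
rewrite -(deriveE u dE) E.
rewrite derive_sum => [|j]; last exact: diff_derivable.
rewrite mxE /drow -big_split/=; apply: eq_bigr => j _.
by rewrite deriveE// diffM_apply// -(diff_entry_comp _ _ dX) [X in _ + X]mulrC.
Qed.

(** Since [J^2 = -1], the only preimage of [w] under [J q] is [- (J q *m w)], and it is tangent
    exactly when row [i] of [J q] kills [w]. *)
Lemma Jtangent_entry J i q w : J q *m J q = - 1%:M ->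
  Jtangent J (fun x => x i 0) q w <-> w i 0 = 0 /\ (J q *m w) i 0 = 0.
Proof.
move=> JJ; rewrite /Jtangent /tangent /= /setI/= diff_entry; split=> [[w0 [v]]|].
  rewrite diff_entry => v0 vw; split=> //.
  by rewrite -vw mulmxA JJ mulNmx mul1mx mxE v0 oppr0.
move=> [w0 Jw0]; split=> //; exists (- (J q *m w)).
  by rewrite diff_entry mxE Jw0 oppr0.
by rewrite mulmxN mulmxA JJ mulNmx mul1mx opprK.
Qed.

(** Each of the eight terms of the brackets is a derivative of a section, seen through row [i] of
    [J]; [mulmx_diff_section] turns it into a derivative of [J], so only pointwise values remain. *)
Lemma levi_polar_entry J i p X Y : (forall q, J q *m J q = - 1%:M) ->
  (forall j k, differentiable (fun q => J q j k) p) -> p i 0 = 0 ->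
  Jsection_at J (fun x => x i 0) p X -> Jsection_at J (fun x => x i 0) p Y ->
  let B u w := drow J i p u w in
  let x := X p in let y := Y p in let jx := J p *m x in let jy := J p *m y in
  levi_polar J (fun x => x i 0) X Y p =
  Complex (B jy x - B x jy + B jx y - B y jx)
          (B y x - B x y + B jy jx - B jx jy).
Proof.
move=> JJ dJ p0 [UX [oUX UXp CX TX]] [UY [oUY UYp CY TY]] B x y jx jy.
have dX : differentiable X p by have [] := CX _ UXp.
have dY : differentiable Y p by have [] := CY _ UYp.
have dJf Z : differentiable Z p -> differentiable (Jfield J Z) p.
  move=> dZ; apply: differentiable_cV => j.
  rewrite (_ : (fun _ => _) = \sum_k (fun q => J q j k * Z q k 0)).
    apply: differentiable_sum => k; apply: differentiableM => //.
    exact: differentiable_entry.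
  by apply/funext => q; rewrite fct_sumE /Jfield mxE.
(* On the hyperplane, row [i] of [J] kills both [Z] and [J Z]: on the latter it gives [- Z_i]. *)
have sec (W : set V) Z : open W -> W p ->
    (forall q, W q -> zeros (fun x => x i 0) q ->
      Jtangent J (fun x => x i 0) q (Z q)) ->
    (\forall q \near p, zeros (fun x => x i 0) q -> (J q *m Z q) i 0 = 0) /\
    (\forall q \near p, zeros (fun x => x i 0) q -> (J q *m Jfield J Z q) i 0 = 0).
  move=> oW Wp TZ; split; near=> q => q0.
    by have /Jtangent_entry[] : Jtangent J (fun x => x i 0) q (Z q)
      by apply: TZ => //; near: q; exact: open_nbhs_nbhs.
  rewrite /Jfield mulmxA JJ mulNmx mul1mx mxE.
  have /Jtangent_entry[//|-> _] : Jtangent J (fun x => x i 0) q (Z q).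
    by apply: TZ => //; near: q; exact: open_nbhs_nbhs.
  by rewrite oppr0.
have [X0 JX0] := sec _ _ oUX UXp TX; have [Y0 JY0] := sec _ _ oUY UYp TY.
have [x0 jx0] : x i 0 = 0 /\ jx i 0 = 0.
  by apply/(Jtangent_entry _ _ (JJ p)); exact: TX.
have [y0 jy0] : y i 0 = 0 /\ jy i 0 = 0.
  by apply/(Jtangent_entry _ _ (JJ p)); exact: TY.
have JB (a b c e : V) : 'd (fun x : V => x i 0) p (J p *m (a - b) + J p *m (c - e)) =
    (J p *m a) i 0 - (J p *m b) i 0 + ((J p *m c) i 0 - (J p *m e) i 0).
  rewrite diff_entry !mulmxBr mxE [X in X + _]mxE [X in _ + X]mxE.
  by congr (_ + _ + (_ + _)); rewrite mxE.
have M Z u := @mulmx_diff_section J i p Z u (dJ i).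
rewrite /levi_polar /bracket; congr Complex.
  etransitivity; first exact: JB.
  rewrite (M X (Jfield J Y p))// (M Y (Jfield J X p))//.
  rewrite (M (Jfield J X) (Y p))//; last exact: dJf.
  rewrite (M (Jfield J Y) (X p))//; last exact: dJf.
  by rewrite /B /x /y /jx /jy /Jfield; ring.
etransitivity; first exact: JB.
rewrite (M X (Y p))// (M Y (X p))//.
rewrite (M (Jfield J X) (Jfield J Y p))//; last exact: dJf.
rewrite (M (Jfield J Y) (Jfield J X p))//; last exact: dJf.
by rewrite /B /x /y /jx /jy /Jfield; ring.
Unshelve. all: by end_near.
Qed.

End LeviOfCoordinate.
(** * The example *)

Section SumOrd6.
Context {R : realType}.

Definition i0 : 'I_6 := ord0.
Definition i1 : 'I_6 := @Ordinal 6 1 isT.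
Definition i2 : 'I_6 := @Ordinal 6 2 isT.
Definition i3 : 'I_6 := @Ordinal 6 3 isT.
Definition i4 : 'I_6 := @Ordinal 6 4 isT.
Definition i5 : 'I_6 := @Ordinal 6 5 isT.

Lemma forall_ord6 (P : 'I_6 -> Prop) :
  P i0 -> P i1 -> P i2 -> P i3 -> P i4 -> P i5 -> forall i, P i.
Proof.
move=> P0 P1 P2 P3 P4 P5 [[|[|[|[|[|[|]]]]]] // Hk].
- by rewrite (_ : Ordinal Hk = i0)//; exact: val_inj.
- by rewrite (_ : Ordinal Hk = i1)//; exact: val_inj.
- by rewrite (_ : Ordinal Hk = i2)//; exact: val_inj.
- by rewrite (_ : Ordinal Hk = i3)//; exact: val_inj.
- by rewrite (_ : Ordinal Hk = i4)//; exact: val_inj.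
- by rewrite (_ : Ordinal Hk = i5)//; exact: val_inj.
Qed.

Lemma sum_ord6 (F : 'I_6 -> R) :
  \sum_i F i = F i0 + F i1 + F i2 + F i3 + F i4 + F i5.
Proof.
rewrite !big_ord_recr big_ord0/= add0r.
by congr (F _ + F _ + F _ + F _ + F _ + F _); exact: val_inj.
Qed.

Definition vec6 (a b c e f g : R) : 'cV[R]_6 :=
  \col_i nth 0 [:: a; b; c; e; f; g] i.

End SumOrd6.

(* The coordinates are [(x1, y1, x2, y2, t, s)] with [z1 = x1 + i y1],
   [z2 = x2 + i y2] and [w = t + i s]; the rows of the matrix of [J] are the
   forms [dx1 \o J, ..., ds \o J]. *)
Section Example.
Context {R : realType}.
Local Notation V := 'cV[R]_6.
Implicit Types (p q u v w : V).

(** The last two rows are the real and imaginary parts of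
    [i dw + 2i a d(conj z1) + 2i b d(conj z2)], where [a = |z1|^2 z1 / 4 - i y2 z1] and
    [b = (z2 - |z1|^2) / 2] are the coefficients of the third (1,0)-form. *)
Definition Jrows (p : V) : seq (seq R) :=
  let x1 := p i0 0 in let y1 := p i1 0 in
  let x2 := p i2 0 in let y2 := p i3 0 in
  let m := x1 * x1 + y1 * y1 in
  [:: [:: 0; -1; 0; 0; 0; 0];
      [:: 1; 0; 0; 0; 0; 0];
      [:: 0; 0; 0; -1; 0; 0];
      [:: 0; 0; 1; 0; 0; 0];
      [:: 2 * (y2 * x1) - 2^-1 * (m * y1); 2^-1 * (m * x1) + 2 * (y2 * y1);
          - y2; x2 - m; 0; -1];
      [:: 2^-1 * (m * x1) + 2 * (y2 * y1); 2^-1 * (m * y1) - 2 * (y2 * x1);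
          x2 - m; y2; 1; 0]].

Definition Jex (p : V) : 'M[R]_6 :=
  \matrix_(i, j) nth 0 (nth [::] (Jrows p) i) j.

Lemma Jex_mulE p v (j : 'I_6) : (Jex p *m v) j 0 =
  let r := nth [::] (Jrows p) j in
  r`_0 * v i0 0 + r`_1 * v i1 0 + r`_2 * v i2 0 + r`_3 * v i3 0
  + r`_4 * v i4 0 + r`_5 * v i5 0.
Proof. by rewrite mxE sum_ord6 !mxE. Qed.

Lemma Jex_sqr p : Jex p *m Jex p = - 1%:M.
Proof.
apply/matrixP; elim/forall_ord6; elim/forall_ord6.
all: rewrite mxE sum_ord6 !mxE/=; ring.
Qed.

Lemma Jex_poly i j : polynomial_fun (fun p => Jex p i j).
Proof.
under eq_fun do rewrite mxE.
have pc c := @poly_cst R 6 c; have px k := @poly_coord R 6 k.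
elim/forall_ord6: i; elim/forall_ord6: j; rewrite /=.
all: by repeat (exact: pc || exact: px || apply: poly_sub || apply: poly_add
  || apply: poly_mul || apply: poly_opp).
Qed.

Lemma Jex_analytic : analytic_almost_complex Jex.
Proof.
move=> p; split; first exact: Jex_sqr.
by move=> i j; exact/poly_analytic/Jex_poly.
Qed.

Definition phiex (p : V) : R := p i4 0.

Lemma phiex_hypersurface : analytic_hypersurface phiex.
Proof.
split=> [p|p _]; first exact/poly_analytic/poly_coord.
exists (delta_mx i4 0); rewrite /phiex diff_entry mxE !eqxx/=; exact: oner_neq0.
Qed.

Lemma drow_Jex p u w : drow Jex i4 p u w =
  let x1 := p i0 0 in let y1 := p i1 0 in
  let x2 := p i2 0 in let y2 := p i3 0 in
  let dm := 2 * (x1 * u i0 0 + y1 * u i1 0) in let m := x1 * x1 + y1 * y1 in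
    (2 * (u i3 0 * x1 + y2 * u i0 0) - 2^-1 * (dm * y1 + m * u i1 0)) * w i0 0
  + (2^-1 * (dm * x1 + m * u i0 0) + 2 * (u i3 0 * y1 + y2 * u i1 0)) * w i1 0
  - u i3 0 * w i2 0 + (u i2 0 - dm) * w i3 0.
Proof.
(* Pairing differentiability with the value of the derivative lets both be assembled along the
   structure of each entry. *)
pose D f g := differentiable (f : V -> R) p /\ 'd f p u = g.
have Dc c : D (fun=> c) 0 by split=> //; rewrite diff_cst.
have Dx k : D (fun x => x k 0) (u k 0).
  by split; [exact: differentiable_coord|rewrite diff_entry].
have Da f g f' g' : D f f' -> D g g' -> D (fun x => f x + g x) (f' + g').
  move=> [df <-] [dg <-]; split; first exact: differentiableD.
  exact: diffD_apply.
have Dm f g f' g' : D f f' -> D g g' ->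
    D (fun x => f x * g x) (f p * g' + g p * f').
  move=> [df <-] [dg <-]; split; first exact: differentiableM.
  exact: diffM_apply.
have Do f f' : D f f' -> D (fun x => - f x) (- f').
  move=> [df <-]; split; first exact: differentiableN.
  by rewrite -[RHS]/((- ('d f p : V -> R)) u) -diffN.
have De j f f' c : (forall q, Jex q i4 j = f q) -> D f f' -> f' = c ->
    'd (fun q => Jex q i4 j) p u = c.
  by move=> /funext -> [_ ->].
have Dmm := Da _ _ _ _ (Dm _ _ _ _ (Dx i0) (Dx i0)) (Dm _ _ _ _ (Dx i1) (Dx i1)).
have D2 c f g f' g' Df Dg := Dm _ _ _ _ (Dc c) (Dm f g f' g' Df Dg).
have E0 := Da _ _ _ _ (D2 2 _ _ _ _ (Dx i3) (Dx i0))
                      (Do _ _ (D2 2^-1 _ _ _ _ Dmm (Dx i1))).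
have E1 := Da _ _ _ _ (D2 2^-1 _ _ _ _ Dmm (Dx i0)) (D2 2 _ _ _ _ (Dx i3) (Dx i1)).
have E3 := Da _ _ _ _ (Dx i2) (Do _ _ Dmm).
pose dm := 2 * (p i0 0 * u i0 0 + p i1 0 * u i1 0).
pose m := p i0 0 * p i0 0 + p i1 0 * p i1 0.
pose L : seq R :=
  [:: 2 * (u i3 0 * p i0 0 + p i3 0 * u i0 0) - 2^-1 * (dm * p i1 0 + m * u i1 0);
      2^-1 * (dm * p i0 0 + m * u i0 0) + 2 * (u i3 0 * p i1 0 + p i3 0 * u i1 0);
      - u i3 0; u i2 0 - dm; 0; 0].
have H j : 'd (fun q => Jex q i4 j) p u = L`_j.
  elim/forall_ord6: j; rewrite /L /dm /m /=.
  - by apply: De E0 _ => [q|]; [rewrite mxE|ring].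
  - by apply: De E1 _ => [q|]; [rewrite mxE|ring].
  - by apply: De (Do _ _ (Dx i3)) _ => [q|]; [rewrite mxE|].
  - by apply: De E3 _ => [q|]; [rewrite mxE|ring].
  - by apply: De (Dc 0) _ => [q|]; [rewrite mxE|].
  - by apply: De (Dc (-1)) _ => [q|]; [rewrite mxE|].
rewrite (drow_eq _ H) sum_ord6 /L /dm /m.
by rewrite /=; ring.
Qed.

(** Row [i4] has coefficient [-1] on [ds], so complex tangency determines the [s]-component from the
    [(z1, z2)]-components, which stay free. *)
Lemma Jtangent_ex p v : Jtangent Jex phiex p v <->
  v i4 0 = 0 /\ v i5 0 = (Jex p *m vec6 (v i0 0) (v i1 0) (v i2 0) (v i3 0) 0 0) i4 0.
Proof.
rewrite (Jtangent_entry _ _ (Jex_sqr p)) !Jex_mulE/= !mxE/=.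
split=> -[v4 v5]; split=> //; last by rewrite v4 v5; ring.
by apply/eqP; rewrite -subr_eq0 -oppr_eq0; apply/eqP; rewrite -[RHS]v5 v4; ring.
Qed.

(* The value is [-4 * conj (d X) * d Y] with [d = dz2 - conj z1 * dz1]. *)
Lemma levi_polar_ex p X Y : zeros phiex p ->
  Jsection_at Jex phiex p X -> Jsection_at Jex phiex p Y ->
  let x1 := p i0 0 in let y1 := p i1 0 in
  let re v := v i2 0 - x1 * v i0 0 - y1 * v i1 0 in
  let im v := v i3 0 - x1 * v i1 0 + y1 * v i0 0 in
  levi_polar Jex phiex X Y p =
  Complex (- 4 * (re (X p) * re (Y p) + im (X p) * im (Y p)))
          (- 4 * (re (X p) * im (Y p) - im (X p) * re (Y p))).
Proof.
move=> p0 sX sY x1 y1 re im.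
rewrite (levi_polar_entry Jex_sqr _ p0 sX sY); last first.
  by move=> j k; exact/poly_differentiable/Jex_poly.
have [U [_ Up _ TX]] := sX; have [W [_ Wp _ TY]] := sY.
have /Jtangent_ex[X4 X5] := TX _ Up p0.
have /Jtangent_ex[Y4 Y5] := TY _ Wp p0.
rewrite !drow_Jex /re /im /x1 /y1 !Jex_mulE/=.
by congr Complex; field.
Qed.

(** The unique complex tangent vector over given [(z1, z2)]-components. For constant [v] it is a
    global section, used to test the Levi form. *)
Definition horizontal_lift v q : V :=
  vec6 (v i0 0) (v i1 0) (v i2 0) (v i3 0) 0
       ((Jex q *m vec6 (v i0 0) (v i1 0) (v i2 0) (v i3 0) 0 0) i4 0).

Lemma horizontal_lift_tangent v q : Jtangent Jex phiex q (horizontal_lift v q).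
Proof.
by apply/Jtangent_ex; rewrite /horizontal_lift ![vec6 _ _ _ _ _ (_ i4 0) _ _]mxE.
Qed.

Lemma horizontal_lift_id v p : Jtangent Jex phiex p v -> horizontal_lift v p = v.
Proof.
move=> /Jtangent_ex[v4 v5]; apply/colP; rewrite /horizontal_lift -v5.
by elim/forall_ord6; rewrite mxE.
Qed.

(** The components to be lifted may vary with the point, which covers constant lifts as well as
    [ker_frame]. *)
Lemma horizontal_lift_poly (F : 'I_6 -> V -> R) i :
  (forall k, polynomial_fun (F k)) ->
  polynomial_fun (fun q => horizontal_lift (\col_k F k q) q i 0).
Proof.
move=> pF; elim/forall_ord6: i; under eq_fun do rewrite mxE /= ?mxE.
all: try exact: pF.
- exact: poly_cst.
- apply: poly_sum => j; apply: poly_mul; first exact: Jex_poly.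
  elim/forall_ord6: j; under eq_fun do rewrite mxE /= ?mxE.
  all: by [exact: pF|exact: poly_cst].
Qed.

Lemma horizontal_lift_section v p : Jsection_at Jex phiex p (horizontal_lift v).
Proof.
exists setT; split=> //; first exact: openT.
  apply: poly_field_C1 => i.
  have vE : \col_k v k 0 = v by apply/colP => k; rewrite mxE.
  rewrite -vE; apply: (@horizontal_lift_poly (fun k _ => v k 0)) => k.
  exact: poly_cst.
by move=> q _ _; exact: horizontal_lift_tangent.
Qed.

(** The two equations are the real and imaginary parts of [dz2 = conj z1 * dz1]. *)
Lemma levi_ker_ex p v : zeros phiex p -> levi_ker Jex phiex p v <->
  [/\ Jtangent Jex phiex p v, v i2 0 = p i0 0 * v i0 0 + p i1 0 * v i1 0 &
      v i3 0 = p i0 0 * v i1 0 - p i1 0 * v i0 0].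
Proof.
move=> p0; split=> [[tv kv]|[tv v2 v3]]; last first.
  split=> // X Y sX sY Xp; rewrite (levi_polar_ex p0 sX sY) Xp v2 v3.
  by apply/eqP; rewrite eq_complex/=; apply/andP; split; apply/eqP; ring.
(* The form [dz2 - conj z1 * dz1] is [1] on the lift of [e2], so pairing with this lift reads off
   its value at [v]. *)
pose e2 : V := vec6 0 0 1 0 0 0.
have sv := horizontal_lift_section v p; have se := horizontal_lift_section e2 p.
have := kv _ _ sv se (horizontal_lift_id tv).
rewrite (levi_polar_ex p0 sv se) horizontal_lift_id// /horizontal_lift.
rewrite ![vec6 _ _ _ _ _ (_ i4 0) _ _]mxE/= ![e2 _ _]mxE/=.
by move/eqP; rewrite eq_complex/= => /andP[/eqP H1 /eqP H2]; split=> //; lra.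
Qed.

Definition ker_frame q : V :=
  horizontal_lift (vec6 1 0 (q i0 0) (- q i1 0) 0 0) q.

Lemma ker_frameE q : ker_frame q =
  let x1 := q i0 0 in let y1 := q i1 0 in let x2 := q i2 0 in let y2 := q i3 0 in
  vec6 1 0 x1 (- y1) 0 (x1 * y2 - y1 * x2 + 2^-1 * (x1 * x1 + y1 * y1) * y1).
Proof.
apply/colP; rewrite /ker_frame /horizontal_lift Jex_mulE/=.
by elim/forall_ord6; rewrite !mxE//= ?mxE/= ?mxE/=; field.
Qed.

Lemma levi_ker_subbundle : complex_line_subbundle Jex phiex (levi_ker Jex phiex).
Proof.
move=> p _; exists setT, ker_frame; split=> //; first exact: openT.
  move=> q _ i j; rewrite ord1; apply: poly_analytic.
  pose F (k : 'I_6) (q : V) := nth 0 [:: 1; 0; q i0 0; - q i1 0; 0; 0] k.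
  apply: (@horizontal_lift_poly F) => k; rewrite /F.
  elim/forall_ord6: k => /=; try exact: poly_cst; first exact: poly_coord.
  exact/poly_opp/poly_coord.
move=> q _ q0; split.
- by move=> v /(levi_ker_ex _ q0)[].
- apply/eqP => /colP/(_ i0); rewrite ker_frameE !mxE/=; apply/eqP.
  exact: oner_neq0.
have E a b k : (a *: ker_frame q + b *: (Jex q *m ker_frame q)) k 0 =
    a * ker_frame q k 0 + b * (Jex q *m ker_frame q) k 0.
  by rewrite mxE [X in X + _]mxE [X in _ + X]mxE.
apply/seteqP; split=> v.
  move=> /(levi_ker_ex _ q0)[/Jtangent_ex[v4 v5] v2 v3].
  (* The [z1]-components of the frame and of its image under [J] are [1] and [i], which dictates the
     coefficients. *)
  exists (v i0 0), (v i1 0); apply/colP => k; rewrite E Jex_mulE ker_frameE/=.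
  move: v5; rewrite Jex_mulE/= !mxE/= => v5.
  by elim/forall_ord6: k => /=; rewrite ?v5 ?v4 ?v3 ?v2; field.
move=> [a [b ->]]; move: (E a b); move: (_ + _) => w Ew; apply/(levi_ker_ex _ q0).
split; last 2 first.
- by rewrite !Ew !Jex_mulE ker_frameE/= !mxE/=; ring.
- by rewrite !Ew !Jex_mulE ker_frameE/= !mxE/=; ring.
apply/Jtangent_ex; rewrite Jex_mulE/= ![vec6 _ _ _ _ _ _ _ _]mxE/=.
by rewrite !Ew !Jex_mulE ker_frameE/= !mxE/=; split; field.
Qed.

Lemma levi_ker_origin : levi_ker Jex phiex 0 (vec6 1 0 0 0 0 0).
Proof.
have z0 : zeros phiex 0 by rewrite /zeros/= /phiex mxE.
apply/(levi_ker_ex _ z0); rewrite !mxE/= !mul0r subr0 addr0; split=> //.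
by apply/Jtangent_ex; rewrite Jex_mulE/= !mxE/=; split=> //; ring.
Qed.

End Example.

(** * Means over circles *)

Section CircleIntegral.
Context {R : realType}.
Local Notation mu := (@lebesgue_measure R).
Implicit Types (F G : R -> R) (h : R * R -> R) (z w : R * R) (r a c : R).

(** Means are kept unnormalised, whence the factors [pi *+ 2] next to constant terms below. *)
Definition cint F : R := \int[mu]_(a in `[0, pi *+ 2]) F a.

Let twopi_gt0 : 0 < pi *+ 2 :> R.
Proof. by rewrite mulrn_wgt0// pi_gt0. Qed.

Lemma cint_integrable F : continuous F -> mu.-integrable `[0, pi *+ 2] (EFin \o F).
Proof.
move=> cF; apply: continuous_compact_integrable; first exact: segment_compact.
exact: continuous_subspaceT.
Qed.

Lemma cintD F G : continuous F -> continuous G ->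
  cint (fun a => F a + G a) = cint F + cint G.
Proof. by move=> cF cG; rewrite /cint RintegralD//; exact: cint_integrable. Qed.

Lemma cintZ c F : continuous F -> cint (fun a => c * F a) = c * cint F.
Proof. by move=> cF; rewrite /cint RintegralZl//; exact: cint_integrable. Qed.

Lemma le_cint F G : continuous F -> continuous G -> (forall a, F a <= G a) ->
  cint F <= cint G.
Proof. by move=> cF cG FG; apply: le_Rintegral => //; exact: cint_integrable. Qed.

Lemma cint_cst c : cint (fun=> c) = c * (pi *+ 2).
Proof.
rewrite /cint Rintegral_cst//= lebesgue_measure_itv/= lte_fin twopi_gt0.
by rewrite -EFinD/= subr0.
Qed.

(** The fundamental theorem of calculus over one period. *)
Lemma cint_derive F f : (forall a, is_derive a 1 F (f a)) -> continuous f ->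
  F (pi *+ 2) = F 0 -> cint f = 0.
Proof.
move=> dF cf F2; rewrite /cint /Rintegral.
have cF : continuous F.
  move=> a; apply: differentiable_continuous; apply/derivable1_diffP.
  exact: (@ex_derive _ _ _ _ _ _ _ (dF a)).
rewrite (@continuous_FTC2 _ f F)//.
- by rewrite F2 -EFinB subrr.
- exact: continuous_subspaceT.
- split=> [a _||]; first exact: (@ex_derive _ _ _ _ _ _ _ (dF a)).
    by apply: cvg_at_right_filter; exact: cF.
  by apply: cvg_at_left_filter; exact: cF.
- by move=> a _; rewrite derive1E (@derive_val _ _ _ _ _ _ _ (dF a)).
Qed.

(** Dominated differentiation under the integral sign; over a bounded interval a constant majorant
    is integrable. *)
Lemma is_derive_cint (K k : R -> R -> R) r u v C : u < r < v ->
  (forall s, u < s < v -> continuous (K s)) ->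
  (forall s a, u < s < v -> is_derive s 1 (K ^~ a) (k s a)) ->
  (forall s a, u < s < v -> 0 <= a <= pi *+ 2 -> `|k s a| <= C) ->
  is_derive r 1 (fun s => cint (K s)) (cint (k r)).
Proof.
move=> ruv cK dK kC.
have kE s a : u < s < v -> partial1of2 K s a = k s a.
  by move=> suv; rewrite partial1of2E (@derive_val _ _ _ _ _ _ _ (dK s a suv)).
have C0 : 0 <= C.
  apply: le_trans (kC r 0 ruv _) => //; by rewrite lexx ltW.
have I s : [set` `]u, v[] s -> u < s < v by rewrite /= in_itv.
have kr : cint (k r) = \int[mu]_(a in `[0, pi *+ 2]) partial1of2 K r a.
  by apply: eq_Rintegral => a _; rewrite kE.
have der := (@derivable_under_integral R _ _ mu K `[0, pi *+ 2] _ r u v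
  _ _ _ (fun=> C) _ _ _).
have dif := (@differentiation_under_integral R _ _ mu K `[0, pi *+ 2] _ r u v
  _ _ _ (fun=> C) _ _ _).
have h1 : measurable [set` `[0, (pi *+ 2 : R)]] by [].
have h2 : [set` `]u, v[] r by rewrite /= in_itv.
have h3 s : [set` `]u, v[] s -> mu.-integrable `[0, pi *+ 2] (EFin \o K s).
  by move=> /I suv; apply: cint_integrable; exact: cK.
have h4 s a : [set` `]u, v[] s -> [set` `[0, (pi *+ 2 : R)]] a ->
    derivable (K ^~ a) s 1.
  by move=> /I suv _; exact: (@ex_derive _ _ _ _ _ _ _ (dK s a suv)).
have h5 : mu.-integrable `[0, pi *+ 2] (EFin \o (fun=> C)).
  by apply: cint_integrable; exact: cst_continuous.
have h6 s a : [set` `]u, v[] s -> [set` `[0, (pi *+ 2 : R)]] a ->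
    `|partial1of2 K s a| <= C.
  by move=> /I suv /=; rewrite in_itv/= kE// => a2; exact: kC.
apply: DeriveDef; first exact: der h1 h2 h3 h4 (fun=> C0) h5 h6.
by rewrite -derive1E kr; exact: dif h1 h2 h3 h4 (fun=> C0) h5 h6.
Qed.

End CircleIntegral.

(** * Radial and tangential derivatives on circles *)

Section CircleMean.
Context {R : realType}.
Implicit Types (h k hx hy kx ky : R * R -> R) (z w : R * R) (r s a c : R).

Definition circ r a : R * R := (r * cos a, r * sin a).

Lemma modulus_circ r a : modulus (circ r a) = `|r|.
Proof.
rewrite /modulus/= !exprMn -mulrDr cos2Dsin2 mulr1.
by rewrite sqrtr_sqr.
Qed.

Lemma circ_unit_disc r a : -1 < r < 1 -> unit_disc (circ r a).
Proof. by move=> r1; rewrite /unit_disc/= modulus_circ ltr_norml. Qed.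

(** Continuous differentiability with the partial derivatives named, so that the closure lemmas
    below compute those of algebraic expressions. *)
Definition has_partials h hx hy := forall z, unit_disc z ->
  [/\ differentiable h z, 'd h z (1, 0) = hx z, 'd h z (0, 1) = hy z,
      {for z, continuous hx} & {for z, continuous hy}].

Lemma has_partials_continuous h hx hy : has_partials h hx hy ->
  forall z, unit_disc z -> {for z, continuous h}.
Proof. by move=> hh z /hh[dh _ _ _ _]; exact: differentiable_continuous. Qed.

Lemma has_partials_cst c : has_partials (fun=> c) (fun=> 0) (fun=> 0).
Proof.
by move=> z _; split; rewrite ?diff_cst//; exact: cst_continuous.
Qed.

Lemma has_partialsD h hx hy k kx ky :
  has_partials h hx hy -> has_partials k kx ky ->
  has_partials (fun z => h z + k z) (fun z => hx z + kx z) (fun z => hy z + ky z).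
Proof.
move=> hh hk z /[dup] /hh[dh <- <- chx chy] /hk[dk <- <- ckx cky].
split; first exact: differentiableD.
- exact: diffD_apply.
- exact: diffD_apply.
- exact: continuousD.
- exact: continuousD.
Qed.

Lemma has_partialsM h hx hy k kx ky :
  has_partials h hx hy -> has_partials k kx ky ->
  has_partials (fun z => h z * k z) (fun z => h z * kx z + k z * hx z)
               (fun z => h z * ky z + k z * hy z).
Proof.
move=> hh hk z /[dup] /hh[dh <- <- chx chy] /hk[dk <- <- ckx cky].
have [ch ck] := (differentiable_continuous dh, differentiable_continuous dk).
split; first exact: differentiableM.
- exact: diffM_apply.
- exact: diffM_apply.
- by apply: continuousD; exact: continuousM.
- by apply: continuousD; exact: continuousM.
Qed.

Lemma has_partialsZ c h hx hy : has_partials h hx hy ->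
  has_partials (fun z => c * h z) (fun z => c * hx z) (fun z => c * hy z).
Proof.
move=> hh; have := has_partialsM (has_partials_cst c) hh.
by congr has_partials; apply/funext => z; rewrite mulr0 addr0.
Qed.

Lemma diff_partials h hx hy z v : has_partials h hx hy -> unit_disc z ->
  'd h z v = v.1 * hx z + v.2 * hy z.
Proof.
move=> hh /hh[dh <- <- _ _].
rewrite [in LHS](_ : v = v.1 *: (1, 0) + v.2 *: (0, 1)).
  by rewrite linearD !linearZ.
by case: v => a b; congr pair; rewrite /=; rewrite ?scaler0 ?addr0 ?add0r [_ *: _]mulr1.
Qed.

Lemma is_derive_partials h hx hy (c1 c2 : R -> R) (t d1 d2 : R) :
  has_partials h hx hy ->
  unit_disc (c1 t, c2 t) -> is_derive t 1 c1 d1 -> is_derive t 1 c2 d2 ->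
  is_derive t 1 (fun s => h (c1 s, c2 s))
    (d1 * hx (c1 t, c2 t) + d2 * hy (c1 t, c2 t)).
Proof.
move=> hh ud D1 D2.
have dc1 : differentiable c1 t.
  by apply/derivable1_diffP; exact: (@ex_derive _ _ _ _ _ _ _ D1).
have dc2 : differentiable c2 t.
  by apply/derivable1_diffP; exact: (@ex_derive _ _ _ _ _ _ _ D2).
have dc : differentiable (fun s => (c1 s, c2 s)) t by exact: differentiable_pair.
have [dh _ _ _ _] := hh _ ud.
have dhc : differentiable (h \o (fun s => (c1 s, c2 s))) t.
  exact: differentiable_comp.
apply: DeriveDef; first exact/derivable1_diffP.
rewrite deriveE// diff_comp//= diff_pair//= (diff_partials _ hh)//=.
by rewrite -!deriveE// (@derive_val _ _ _ _ _ _ _ D1) (@derive_val _ _ _ _ _ _ _ D2).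
Qed.

Lemma continuous_pairfun (T : topologicalType) (f g : T -> R) (x : T) :
  {for x, continuous f} -> {for x, continuous g} ->
  {for x, continuous (fun y => (f y, g y))}.
Proof. by move=> cf cg; exact: (cvg_pair cf cg). Qed.

Lemma continuous_circ h r : (forall z, unit_disc z -> {for z, continuous h}) ->
  -1 < r < 1 -> continuous (fun a => h (circ r a)).
Proof.
move=> ch r1 a; apply: (@continuous_comp _ _ _ (circ r) h); last first.
  exact/ch/circ_unit_disc.
apply: continuous_pairfun.
  by apply: cvgM; [exact: cvg_cst|exact: continuous_cos].
by apply: cvgM; [exact: cvg_cst|exact: continuous_sin].
Qed.

Lemma bounded_circ h c : (forall z, unit_disc z -> {for z, continuous h}) ->
  c < 1 -> exists C, forall s a, `|s| <= c -> 0 <= a <= pi *+ 2 ->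
    `|h (circ s a)| <= C.
Proof.
move=> ch c1.
pose K := [set` `[-c, c]] `*` [set` `[0, (pi *+ 2 : R)]].
have cK : compact K by apply: compact_setX; exact: segment_compact.
have : compact ((fun x => h (circ x.1 x.2)) @` K).
  apply: continuous_compact => //; apply: continuous_in_subspaceT => -[s a].
  rewrite inE /K/= !in_itv/= => -[sc a2].
  apply: (@continuous_comp _ _ _ (fun x : R * R => circ x.1 x.2) h); last first.
    by apply/ch/circ_unit_disc; rewrite -ltr_norml (le_lt_trans _ c1)// ler_norml.
  apply: continuous_pairfun; apply: cvgM; try exact: cvg_fst.
    by apply: (@continuous_comp _ _ _ snd cos); [exact: cvg_snd|exact: continuous_cos].
  by apply: (@continuous_comp _ _ _ snd sin); [exact: cvg_snd|exact: continuous_sin].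
move=> /compact_bounded [M [_ MC]]; exists (M + 1) => s a sc a2.
(* [compact_bounded] provides the bound only for numbers strictly above [M]. *)
apply: (MC (M + 1)); first by rewrite ltrDl.
by exists (s, a) => //; split; rewrite /= in_itv/= -?ler_norml.
Qed.

Let is_derive_scale (k s : R) : is_derive s 1 (fun x : R => x * k) k.
Proof.
have H : is_derive s 1 (id * cst k : R -> R) (s *: 0 + k *: 1) by exact: is_deriveM.
apply: (is_derive_eq (f := fun x : R => x * k) H).
by rewrite scaler0 add0r [_ *: _]mulr1.
Qed.

(** Negative radii are allowed so that [0] is an interior point; continuity there serves the mean
    value theorem on [[0, r]]. *)
Lemma is_derive_cmean h hx hy r : has_partials h hx hy -> -1 < r < 1 ->
  is_derive r 1 (fun s => cint (fun a => h (circ s a)))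
    (cint (fun a => cos a * hx (circ r a) + sin a * hy (circ r a))).
Proof.
move=> hh r1.
have chx z : unit_disc z -> {for z, continuous hx} by move=> /hh[].
have chy z : unit_disc z -> {for z, continuous hy} by move=> /hh[].
(* On the closed disc of radius [c < 1] compactness bounds the partial derivatives. *)
have [c rc c1] : exists2 c, `|r| < c & c < 1.
  have r1' : `|r| < 1 by rewrite ltr_norml.
  by exists ((`|r| + 1) / 2); lra.
have [C1 hC1] := bounded_circ chx c1; have [C2 hC2] := bounded_circ chy c1.
have in1 s : - c < s < c -> -1 < s < 1.
  by move=> /andP[? ?]; apply/andP; split; lra.
apply: (@is_derive_cint R (fun s a => h (circ s a))
  (fun s a => cos a * hx (circ s a) + sin a * hy (circ s a)) r (- c) c (C1 + C2)).
- by rewrite -ltr_norml.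
- move=> s /in1 s1; apply: continuous_circ => //.
  exact: has_partials_continuous hh.
- move=> s a /in1 s1; apply: (is_derive_partials hh).
    exact: circ_unit_disc.
  + exact: is_derive_scale.
  + exact: is_derive_scale.
- move=> s a sc a2; apply: (le_trans (ler_normD _ _)).
  have sc' : `|s| <= c by rewrite ltW// ltr_norml.
  apply: lerD; rewrite normrM.
    by rewrite (le_trans _ (hC1 s a sc' a2))// ler_piMl// cos_max.
  by rewrite (le_trans _ (hC2 s a sc' a2))// ler_piMl// sin_max.
Qed.

(** Multiplied by [r], the integrand is the derivative in the angle of the periodic function
    [h (circ r a)]. *)
Lemma cint_tangential h hx hy r : has_partials h hx hy -> 0 < r < 1 ->
  cint (fun a => cos a * hy (circ r a) - sin a * hx (circ r a)) = 0.
Proof.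
move=> hh /andP[r0 r1].
have r11 : -1 < r < 1 by rewrite r1 andbT; lra.
have chx z : unit_disc z -> {for z, continuous hx} by move=> /hh[].
have chy z : unit_disc z -> {for z, continuous hy} by move=> /hh[].
have cc : continuous (fun a => cos a * hy (circ r a) - sin a * hx (circ r a)).
  move=> a; apply: cvgB; apply: cvgM; [exact: continuous_cos|
    exact: continuous_circ|exact: continuous_sin|exact: continuous_circ].
have : cint (fun a => r * (cos a * hy (circ r a) - sin a * hx (circ r a))) = 0.
  apply: (@cint_derive _ (fun a => h (circ r a))).
  - move=> a; apply: is_derive_eq.
      apply: (@is_derive_partials _ _ _ (fun a => r * cos a) (fun a => r * sin a) a
        (r * - sin a) (r * cos a) hh).
      exact: circ_unit_disc.
    by rewrite -/(circ r a); ring.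
  - by move=> a; apply: cvgM; [exact: cvg_cst|exact: cc].
  - by rewrite /circ cos2pi sin2pi cos0 sin0.
rewrite cintZ// => /eqP; rewrite mulf_eq0 gt_eqF//= => /eqP; exact.
Qed.

End CircleMean.

(** * Discs tangent to the kernel *)

Section RealEstimates.
Context {R : realFieldType}.
Implicit Types (r c s A B e t f g p d : R).

Lemma ler_normM (x y X Y : R) : `|x| <= X -> `|y| <= Y -> `|x * y| <= X * Y.
Proof. by move=> xX yY; rewrite normrM ler_pM. Qed.

Lemma ler_normD3 (x y z X Y Z : R) : `|x| <= X -> `|y| <= Y -> `|z| <= Z ->
  `|x + y + z| <= X + Y + Z.
Proof.
move=> xX yY zZ; rewrite (le_trans (ler_normD _ _))// lerD//.
by rewrite (le_trans (ler_normD _ _))// lerD.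
Qed.

(** Here [(c, s)] is the unit radial vector and [A + i B] stands for [f * conj f']. In the rotated
    frame [A + i B] is [r + u + i v] with [u], [v] of size [e * r]; the main term [- (2 * r) * g1]
    is isolated because its mean vanishes. *)
Lemma radial_estimate r c s A B g1 g2 e : 0 < r -> `|c| <= 1 -> `|s| <= 1 ->
  c ^+ 2 + s ^+ 2 = 1 -> `|A - r * c| <= e * r -> `|B - r * s| <= e * r ->
  - 2 * ((A * c + B * s) * g1 + (B * c - A * s) * g2) <=
  - (2 * r) * g1 + (4 * e * r ^+ 3 + 2 * e / r * (g1 ^+ 2 + g2 ^+ 2)).
Proof.
move=> r0 c1 s1 cs hA hB.
have e0 : 0 <= e.
  by rewrite -(pmulr_lge0 _ r0); apply: le_trans hA.
set u := (A - r * c) * c + (B - r * s) * s.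
set v := (B - r * s) * c - (A - r * c) * s.
have -> : - 2 * ((A * c + B * s) * g1 + (B * c - A * s) * g2) =
    - (2 * r) * g1 + - 2 * (u * g1 + v * g2).
  have -> : A * c + B * s = u + r.
    by rewrite -[r in RHS]mulr1 -cs /u; ring.
  by rewrite /u /v; ring.
have := ler_normM hA c1; have := ler_normM hA s1.
have := ler_normM hB c1; have := ler_normM hB s1.
rewrite !mulr1 => h1 h2 h3 h4.
have hu : `|u| <= 2 * e * r by rewrite /u (le_trans (ler_normD _ _))//; lra.
have hv : `|v| <= 2 * e * r by rewrite /v (le_trans (ler_normB _ _))//; lra.
(* This is [2 r^2 |g| <= r^4 + g^2] scaled by [2 e / r]. *)
have key (x g : R) : `|x| <= 2 * e * r ->
    - 2 * (x * g) <= 2 * e * r ^+ 3 + 2 * e / r * g ^+ 2.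
  move=> hx; have : - 2 * (x * g) <= 2 * (2 * e * r * `|g|).
    by have := ler_normM hx (lexx `|g|); rewrite ler_norml => /andP[]; lra.
  move/le_trans; apply.
  have -> : 2 * e * r ^+ 3 + 2 * e / r * g ^+ 2 =
      2 * e / r * ((r ^+ 2 - `|g|) ^+ 2 + 2 * r ^+ 2 * `|g|).
    rewrite -(real_normK (num_real g)); field; exact: lt0r_neq0.
  have -> : 2 * (2 * e * r * `|g|) = 2 * e / r * (2 * r ^+ 2 * `|g|).
    field; exact: lt0r_neq0.
  apply: ler_wpM2l; first by rewrite divr_ge0 ?mulr_ge0// ltW.
  by rewrite lerDr sqr_ge0.
have := key _ g1 hu; have := key _ g2 hv; lra.
Qed.

(** With [m = |f|^2] close to [r^2], one has [m^2 / 8 >= 9/80 r^4], and replacing [m * g1] by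
    [r^2 * g1] costs at most [(r^4 + g1^2) / 40]. The constants fit: [9/80 - 1/40 - 1/100 >= 3/40]
    and [1/2 - 1/40 >= 47/100]. *)
Lemma potential_estimate r c s f1 f2 g1 g2 t : 0 < r -> `|c| <= 1 -> `|s| <= 1 ->
  c ^+ 2 + s ^+ 2 = 1 ->
  `|f1 - r * c| <= 100^-1 * r -> `|f2 - r * s| <= 100^-1 * r ->
  `|t| <= 100^-1 * r ^+ 4 ->
  - r ^+ 2 * g1 + (3 / 40 * r ^+ 4 + 47 / 100 * (g1 * g1 + g2 * g2)) <=
  t + (8^-1 * ((f1 * f1 + f2 * f2) * (f1 * f1 + f2 * f2))
       + 2^-1 * (g1 * g1 + g2 * g2) - (f1 * f1 + f2 * f2) * g1).
Proof.
move=> r0 c1 s1 cs h1 h2 ht; set m := f1 * f1 + f2 * f2.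
have r4 : 0 < r ^+ 4 by rewrite exprn_gt0.
set e1 := f1 - r * c; set e2 := f2 - r * s.
have mE : m - r ^+ 2 = 2 * (r * (e1 * c + e2 * s)) + (e1 * e1 + e2 * e2).
  transitivity (2 * (r * (e1 * c + e2 * s)) + (e1 * e1 + e2 * e2)
                + r ^+ 2 * (c ^+ 2 + s ^+ 2 - 1)).
    by rewrite /m /e1 /e2; ring.
  by rewrite cs subrr mulr0 addr0.
have hm : `|m - r ^+ 2| <= 20^-1 * r ^+ 2.
  have a1 := ler_normM h1 c1; have a2 := ler_normM h2 s1.
  have a3 := ler_normM h1 h1; have a4 := ler_normM h2 h2.
  have a5 : `|e1 * c + e2 * s| <= 50^-1 * r.
    by rewrite (le_trans (ler_normD _ _))//; lra.
  have a6 : `|r * (e1 * c + e2 * s)| <= r * (50^-1 * r).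
    by apply: ler_normM => //; rewrite gtr0_norm.
  rewrite mE (le_trans (ler_normD _ _))// normrM (@ger0_norm _ 2)//.
  have := ler_normD (e1 * e1) (e2 * e2).
  have : 0 <= r ^+ 2 by exact: sqr_ge0.
  rewrite -/e1 -/e2 in a3 a4.
  have rr : r ^+ 2 = r * r by rewrite expr2.
  rewrite rr; lra.
have hg : `|(m - r ^+ 2) * g1| <= 40^-1 * (r ^+ 4 + g1 * g1).
  apply: (le_trans (ler_normM hm (lexx `|g1|))).
  have -> : 40^-1 * (r ^+ 4 + g1 * g1) =
      40^-1 * (r ^+ 2 - `|g1|) ^+ 2 + 20^-1 * r ^+ 2 * `|g1|.
    by rewrite -[g1 * g1]expr2 -(real_normK (num_real g1)); field.
  by rewrite lerDr mulr_ge0 ?sqr_ge0.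
have mm : 9 / 10 * r ^+ 4 <= m * m.
  have -> : m * m = (m - r ^+ 2) ^+ 2 + 2 * r ^+ 2 * (m - r ^+ 2) + r ^+ 4 by ring.
  have : `|r ^+ 2 * (m - r ^+ 2)| <= r ^+ 2 * (20^-1 * r ^+ 2).
    by apply: ler_normM => //; rewrite ger0_norm// sqr_ge0.
  have -> : r ^+ 2 * (20^-1 * r ^+ 2) = 20^-1 * r ^+ 4 by ring.
  have := sqr_ge0 (m - r ^+ 2).
  by rewrite ler_norml => ? /andP[? ?]; lra.
have g20 : 0 <= g2 * g2 by rewrite -expr2 sqr_ge0.
have g10 : 0 <= g1 * g1 by rewrite -expr2 sqr_ge0.
move: hg ht; rewrite !ler_norml mulrBl => /andP[? ?] /andP[? ?].
lra.
Qed.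

(** With [p = f'], this splits [f * conj p - zeta] as [(f - zeta) + f * conj (p - 1)]; the errors
    add up to [(1 + 3/2 + 3/2) d r]. *)
Lemma rotation_estimate d r c s f1 f2 p1 p2 : 0 < r -> d <= 2^-1 ->
  `|c| <= 1 -> `|s| <= 1 -> `|f1 - r * c| <= d * r -> `|f2 - r * s| <= d * r ->
  `|p1 - 1| <= d -> `|p2| <= d ->
  `|f1 * p1 + f2 * p2 - r * c| <= 4 * d * r /\
  `|f2 * p1 - f1 * p2 - r * s| <= 4 * d * r.
Proof.
move=> r0 d2 c1 s1 h1 h2 hp1 hp2.
have hrc : `|r * c| <= r * 1 by apply: ler_normM => //; rewrite gtr0_norm.
have hrs : `|r * s| <= r * 1 by apply: ler_normM => //; rewrite gtr0_norm.
have dr : d * r <= 2^-1 * r by rewrite ler_wpM2r// ltW.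
have hf (x y : R) : `|x - y| <= d * r -> `|y| <= r * 1 -> `|x| <= 3 / 2 * r.
  by move=> xy hy; rewrite -(subrK y x) (le_trans (ler_normD _ _))//; lra.
have hf1 := hf _ _ h1 hrc; have hf2 := hf _ _ h2 hrs.
have a1 := ler_normM hf1 hp1; have a2 := ler_normM hf1 hp2.
have a3 := ler_normM hf2 hp1; have a4 := ler_normM hf2 hp2.
split.
  have -> : f1 * p1 + f2 * p2 - r * c = f1 - r * c + f1 * (p1 - 1) + f2 * p2 by ring.
  by apply: (le_trans (ler_normD3 h1 a1 a4)); lra.
have -> : f2 * p1 - f1 * p2 - r * s = f2 - r * s + f2 * (p1 - 1) + - (f1 * p2) by ring.
by rewrite -normrN in a2; apply: (le_trans (ler_normD3 h2 a3 a2)); lra.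
Qed.

End RealEstimates.

(** * Contradiction from the mean of [t + P] *)

Section NoHighOrderDisc.
Context {R : realType}.
Implicit Types (h hx hy k kx ky : R * R -> R) (r a K : R).

Lemma cint_circ0 h : cint (fun a => h (circ 0 a)) = h (0, 0) * (pi *+ 2).
Proof.
rewrite -cint_cst; congr cint; apply/funext => a.
by rewrite /circ !mul0r.
Qed.

(** The circle of radius [0] is a point, so the integral starts from zero there. *)
Lemma cmean_MVT h hx hy r : has_partials h hx hy -> 0 < r < 1 -> h (0, 0) = 0 ->
  exists2 s : R, 0 < s < r & cint (fun a => h (circ r a)) =
    cint (fun a => cos a * hx (circ s a) + sin a * hy (circ s a)) * r.
Proof.
move=> hh /andP[r0 r1] h0.
have D (s : R) : -1 < s < 1 -> is_derive s 1 (fun s => cint (fun a => h (circ s a)))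
    (cint (fun a => cos a * hx (circ s a) + sin a * hy (circ s a))).
  exact: is_derive_cmean.
pose dm s := cint (fun a => cos a * hx (circ s a) + sin a * hy (circ s a)).
have [||s] := MVT r0 (f := fun s => cint (fun a => h (circ s a))) (df := dm).
- by move=> s; rewrite in_itv/= => /andP[? ?]; apply: D; apply/andP; split; lra.
- apply: derivable_within_continuous => s; rewrite in_itv/= => /andP[? ?].
  apply: (@ex_derive _ _ _ _ _ _ _ (D s _)); apply/andP; split; lra.
by rewrite in_itv/= cint_circ0 h0 mul0r !subr0 => sr ->; exists s.
Qed.

(** By the Cauchy-Riemann equations the radial derivative of [h] is the tangential derivative of
    [k], whose mean is zero. This is the mean value property using first derivatives only. *)
Lemma cmean_harmonic h hx hy k kx ky r :
  has_partials h hx hy -> has_partials k kx ky ->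
  (forall z, unit_disc z -> hx z = ky z /\ hy z = - kx z) ->
  0 < r < 1 -> h (0, 0) = 0 -> cint (fun a => h (circ r a)) = 0.
Proof.
move=> hh hk CR r1 h0; have [s /andP[s0 sr] ->] := cmean_MVT hh r1 h0.
have s1 : 0 < s < 1 by case/andP: r1 => ? ?; apply/andP; split; lra.
rewrite [X in X * _](_ : _ = 0) ?mul0r// -[RHS](cint_tangential hk s1).
congr cint; apply/funext => a.
have /CR[-> ->] : unit_disc (circ s a).
  by apply: circ_unit_disc; case/andP: s1 => ? ?; apply/andP; split; lra.
by rewrite mulrN.
Qed.

(** The disc is [z1 = f1 + i f2], [z2 = g1 + i g2], [w = t + i s]. Condition [CR] below is
    J-holomorphy: Cauchy-Riemann for [z1] and [z2], then the last two rows of [Jrows]. *)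
Context {f1 f2 g1 g2 t s : R * R -> R}.
Context {f1x f2x g1x g2x tx sx f1y f2y g1y g2y ty sy : R * R -> R}.
Context (Df1 : has_partials f1 f1x f1y) (Df2 : has_partials f2 f2x f2y)
  (Dg1 : has_partials g1 g1x g1y) (Dg2 : has_partials g2 g2x g2y)
  (Dt : has_partials t tx ty) (Ds : has_partials s sx sy).
Context (CR : forall z, unit_disc z ->
  let m := f1 z * f1 z + f2 z * f2 z in
  [/\ f1y z = - f2x z, f2y z = f1x z, g1y z = - g2x z, g2y z = g1x z &
   ty z = (2 * (g2 z * f1 z) - 2^-1 * (m * f2 z)) * f1x z
     + (2^-1 * (m * f1 z) + 2 * (g2 z * f2 z)) * f2x z
     - g2 z * g1x z + (g1 z - m) * g2x z - sx z /\
   sy z = (2^-1 * (m * f1 z) + 2 * (g2 z * f2 z)) * f1x z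
     + (2^-1 * (m * f2 z) - 2 * (g2 z * f1 z)) * f2x z
     + (g1 z - m) * g1x z + g2 z * g2x z + tx z]).

(* [t + P] is the real part of a function [K] with
   [d K / d (conj zeta) = - f * conj g * conj f'], where [P] is the potential
   in the definition of [Jex]. *)
Let k z := t z
  + (8^-1 * ((f1 z * f1 z + f2 z * f2 z) * (f1 z * f1 z + f2 z * f2 z))
     + 2^-1 * (g1 z * g1 z + g2 z * g2 z) - (f1 z * f1 z + f2 z * f2 z) * g1 z).

(** [A] and [B] are the real and imaginary parts of [f * conj f']. *)
Let A z := f1 z * f1x z + f2 z * f2x z.
Let B z := f2 z * f1x z - f1 z * f2x z.

(** Real and imaginary parts of the equation for [K = k + i s]. Radially, the terms in [s] form a
    tangential derivative and disappear in the mean. *)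
Let kx z := sy z - 2 * (A z * g1 z + B z * g2 z).
Let ky z := - sx z - 2 * (B z * g1 z - A z * g2 z).

Let Dk : has_partials k kx ky.
Proof.
have Dm := has_partialsD (has_partialsM Df1 Df1) (has_partialsM Df2 Df2).
have Dg := has_partialsD (has_partialsM Dg1 Dg1) (has_partialsM Dg2 Dg2).
have := has_partialsD Dt (has_partialsD (has_partialsD
  (has_partialsZ 8^-1 (has_partialsM Dm Dm)) (has_partialsZ 2^-1 Dg))
  (has_partialsZ (-1) (has_partialsM Dm Dg1))).
have kE : k = fun z : R * R => t z
    + (8^-1 * ((f1 z * f1 z + f2 z * f2 z) * (f1 z * f1 z + f2 z * f2 z))
       + 2^-1 * (g1 z * g1 z + g2 z * g2 z)
       + -1 * ((f1 z * f1 z + f2 z * f2 z) * g1 z)).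
  by apply/funext => z; rewrite /k mulN1r.
rewrite -kE => H z /[dup] /CR[E1 E2 E3 E4 [E5 E6]] /[dup] ud /H[dk -> -> _ _].
have [_ _ _ cf1x _] := Df1 ud; have [_ _ _ cf2x _] := Df2 ud.
have [_ _ _ csx csy] := Ds ud.
have [cf1 cf2 cg1 cg2] := And4 (has_partials_continuous Df1 ud)
  (has_partials_continuous Df2 ud) (has_partials_continuous Dg1 ud)
  (has_partials_continuous Dg2 ud).
have cA : {for z, continuous A} by apply: continuousD; exact: continuousM.
have cB : {for z, continuous B} by apply: continuousB; exact: continuousM.
split=> //.
- by rewrite /kx /A /B E6; field.
- by rewrite /ky /A /B E1 E2 E3 E4 E5; field.
- apply: continuousB => //; apply: continuousM; first exact: cst_continuous.
  by apply: continuousD; exact: continuousM.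
- apply: continuousB; first exact: continuousN.
  apply: continuousM; first exact: cst_continuous.
  by apply: continuousB; exact: continuousM.
Qed.

Let cc h hx hy r : has_partials h hx hy -> 0 < r < 1 ->
  continuous (fun a => h (circ r a)).
Proof.
move=> hh /andP[? ?]; apply: continuous_circ; last by apply/andP; split; lra.
exact: has_partials_continuous hh.
Qed.

Let ccx h hx hy r : has_partials h hx hy -> 0 < r < 1 ->
  continuous (fun a => hx (circ r a)) /\ continuous (fun a => hy (circ r a)).
Proof.
move=> hh /andP[? ?]; split; apply: continuous_circ.
- by move=> z /hh[].
- by apply/andP; split; lra.
- by move=> z /hh[].
- by apply/andP; split; lra.
Qed.

Context {r0 : R} (r0_gt0 : 0 < r0) (r0_lt1 : r0 < 1).
Context (at0 : [/\ f1 (0, 0) = 0, f2 (0, 0) = 0, g1 (0, 0) = 0, g2 (0, 0) = 0 &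
  t (0, 0) = 0]).
(** The constant [100^-1 / 4] becomes [100^-1] through the factor [4] of [rotation_estimate]. *)
Context (small : forall r a, 0 < r < r0 ->
  [/\ `|f1 (circ r a) - r * cos a| <= (100^-1 / 4) * r,
      `|f2 (circ r a) - r * sin a| <= (100^-1 / 4) * r,
      `|f1x (circ r a) - 1| <= (100^-1 / 4), `|f2x (circ r a)| <= (100^-1 / 4) &
      [/\ `|t (circ r a)| <= 100^-1 * r ^+ 4, `|g1 (circ r a)| <= r &
          `|g2 (circ r a)| <= r]]).

Let g z := g1 z * g1 z + g2 z * g2 z.
Let N r := cint (fun a => g (circ r a)).

Let in1 r : 0 < r < r0 -> 0 < r < 1.
Proof. by move=> /andP[-> /lt_trans ->]. Qed.

Let cg r : 0 < r < r0 -> continuous (fun a => g (circ r a)).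
Proof.
move=> /in1 r1 a; apply: cvgD; apply: cvgM;
  by [exact: (cc Dg1 r1)|exact: (cc Dg2 r1)].
Qed.

Let mean_g1 r : 0 < r < 1 -> cint (fun a => g1 (circ r a)) = 0.
Proof.
move=> r1; apply: (cmean_harmonic Dg1 Dg2) => //; last by have [] := at0.
by move=> z /CR[_ _ -> -> _].
Qed.

(** [potential_estimate] integrated; the term [- r ^+ 2 * g1] has mean zero. *)
Let mean_k_lower r : 0 < r < r0 ->
  3 / 40 * r ^+ 4 * (pi *+ 2) + 47 / 100 * N r <= cint (fun a => k (circ r a)).
Proof.
move=> rr0; have r1 := in1 rr0; have cg1 := cc Dg1 r1.
have cL : continuous (fun a => - r ^+ 2 * g1 (circ r a)).
  by move=> a; apply: cvgM; [exact: cvg_cst|exact: cg1].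
have cG : continuous (fun a => 47 / 100 * g (circ r a)).
  by move=> a; apply: cvgM; [exact: cvg_cst|exact: (cg rr0)].
have cC : continuous (fun _ : R => 3 / 40 * r ^+ 4) by exact: cst_continuous.
have cCG : continuous (fun a => 3 / 40 * r ^+ 4 + 47 / 100 * g (circ r a)).
  by move=> a; apply: cvgD; [exact: cC|exact: cG].
have <- : cint (fun a => - r ^+ 2 * g1 (circ r a) +
    (3 / 40 * r ^+ 4 + 47 / 100 * g (circ r a))) =
    3 / 40 * r ^+ 4 * (pi *+ 2) + 47 / 100 * N r.
  rewrite cintD// cintD// cint_cst !cintZ ?mean_g1 ?mulr0 ?add0r//.
  exact: (cg rr0).
apply: le_cint.
- by move=> a; apply: cvgD; [exact: cL|exact: cCG].
- exact: (cc Dk r1).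
move=> a; have [h1 h2 _ _ [h3 _ _]] := small a rr0.
have [r_gt0 _] := andP rr0.
have r4 : 100^-1 / 4 * r <= 100^-1 * r by lra.
exact: (potential_estimate _ _ r_gt0 (cos_max a) (sin_max a) (cos2Dsin2 a)
  (le_trans h1 r4) (le_trans h2 r4) h3).
Qed.

(** The mean value theorem reduces to the radial derivative at some radius [x < r]. There the terms
    in [s] and [- (2 * x) * g1] integrate to zero, leaving the errors of [radial_estimate] with
    [e = 100^-1]. *)
Let mean_k_upper K r : 0 <= K ->
  (forall r, 0 < r < r0 -> N r <= K * r ^+ 2) -> 0 < r < r0 ->
  cint (fun a => k (circ r a)) <=
  25^-1 * r ^+ 4 * (pi *+ 2) + 50^-1 * K * r ^+ 2.
Proof.
move=> K0 NK rr0; have r1 := in1 rr0.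
have k0 : k (0, 0) = 0.
  by have [E1 E2 E3 E4 E5] := at0; rewrite /k E1 E2 E3 E4 E5; ring.
have [x /andP[x0 xr] ->] := cmean_MVT Dk r1 k0.
have [r_gt0 r_lt0] := andP rr0.
have xr0 : 0 < x < r0 by rewrite x0 (lt_trans xr).
have x1 := in1 xr0.
pose T a := cos a * sy (circ x a) - sin a * sx (circ x a).
have cT : continuous T.
  have [csx csy] := ccx Ds x1.
  move=> a; apply: cvgB; apply: cvgM;
    by [exact: continuous_cos|exact: continuous_sin|exact: csx|exact: csy].
have cg1 := cc Dg1 x1.
have cL : continuous (fun a => - (2 * x) * g1 (circ x a)).
  by move=> a; apply: cvgM; [exact: cvg_cst|exact: cg1].
have cG : continuous (fun a => 2 * 100^-1 / x * g (circ x a)).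
  by move=> a; apply: cvgM; [exact: cvg_cst|exact: (cg xr0)].
have cC : continuous (fun _ : R => 4 * 100^-1 * x ^+ 3) by exact: cst_continuous.
have cCG : continuous (fun a => 4 * 100^-1 * x ^+ 3 + 2 * 100^-1 / x * g (circ x a)).
  by move=> a; apply: cvgD; [exact: cC|exact: cG].
have cLCG : continuous (fun a => - (2 * x) * g1 (circ x a) +
    (4 * 100^-1 * x ^+ 3 + 2 * 100^-1 / x * g (circ x a))).
  by move=> a; apply: cvgD; [exact: cL|exact: cCG].
have : cint (fun a => cos a * kx (circ x a) + sin a * ky (circ x a)) <=
    4 * 100^-1 * x ^+ 3 * (pi *+ 2) + 2 * 100^-1 / x * N x.
  have <- : cint (fun a => T a + (- (2 * x) * g1 (circ x a) +
      (4 * 100^-1 * x ^+ 3 + 2 * 100^-1 / x * g (circ x a)))) =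
      4 * 100^-1 * x ^+ 3 * (pi *+ 2) + 2 * 100^-1 / x * N x.
    rewrite (cintD cT cLCG) (cintD cL cCG) (cintD cC cG).
    rewrite (cint_tangential Ds x1) add0r.
    rewrite cint_cst !cintZ ?mean_g1 ?mulr0 ?add0r//; exact: (cg xr0).
  have [ckx cky] := ccx Dk x1.
  apply: le_cint.
  - move=> a; apply: cvgD; apply: cvgM;
      by [exact: continuous_cos|exact: continuous_sin|exact: ckx|exact: cky].
  - by move=> a; apply: cvgD; [exact: cT|exact: cLCG].
  move=> a; have [h1 h2 h3 h4 _] := small a xr0.
  have d2 : 100^-1 / 4 <= 2^-1 :> R by lra.
  have [hA hB] := rotation_estimate x0 d2 (cos_max a) (sin_max a) h1 h2 h3 h4.
  have := radial_estimate (g1 (circ x a)) (g2 (circ x a)) x0 (cos_max a)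
    (sin_max a) (cos2Dsin2 a) hA hB.
  by rewrite /T /kx /ky /g -!expr2 /A /B; lra.
move=> kub; rewrite (le_trans (ler_wpM2r (ltW r_gt0) kub))//.
have x3 : x ^+ 3 <= r ^+ 3 by rewrite lerXn2r ?nnegrE ?ltW.
(* The assumed quadratic bound on [N] absorbs the factor [1 / x], uniformly in the unknown [x]. *)
have Nx : N x / x <= K * r.
  rewrite ler_pdivrMr// (le_trans (NK x xr0))// expr2 mulrA.
  by rewrite (ler_wpM2r (ltW x0))// ler_wpM2l// ltW.
have -> : 4 * 100^-1 * x ^+ 3 * (pi *+ 2) + 2 * 100^-1 / x * N x =
    25^-1 * (pi *+ 2) * x ^+ 3 + 50^-1 * (N x / x).
  by field; exact: lt0r_neq0.
have -> : 25^-1 * r ^+ 4 * (pi *+ 2) + 50^-1 * K * r ^+ 2 =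
    (25^-1 * (pi *+ 2) * r ^+ 3 + 50^-1 * (K * r)) * r by ring.
rewrite (ler_wpM2r (ltW r_gt0))// lerD//; last by rewrite ler_wpM2l.
by rewrite ler_wpM2l// mulr_ge0// mulrn_wge0// pi_ge0.
Qed.

(** The lower bound wins at order [r^4]: [3/40 - 1/25 = 7/200]. *)
Let mean_g_bound K : 0 <= K -> (forall r, 0 < r < r0 -> N r <= K * r ^+ 2) ->
  forall r, 0 < r < r0 ->
  47 / 100 * N r + 7 / 200 * r ^+ 4 * (pi *+ 2) <= 50^-1 * K * r ^+ 2.
Proof.
move=> K0 NK r rr0.
have := mean_k_lower rr0; have := mean_k_upper K0 NK rr0.
by move: (cint _) (N r) => I n; lra.
Qed.

(* The bound [N r <= K * r ^ 2] improves itself to [K / 2], hence [N = 0], and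
   then [mean_g_bound] fails because of its term of order [r ^ 4]. *)
Lemma no_high_order_disc : False.
Proof.
have pi2 : 0 < pi *+ 2 :> R by rewrite mulrn_wgt0// pi_gt0.
(* [K 0] comes from [|g1|, |g2| <= r]. Each use of [mean_g_bound] multiplies the constant by [2/47],
   which is less than [1/2]. *)
pose K (n : nat) : R := 2 * (pi *+ 2) / 2 ^+ n.
have K0 n : 0 <= K n by rewrite divr_ge0 ?exprn_ge0// mulr_ge0// ltW.
have NK n r : 0 < r < r0 -> N r <= K n * r ^+ 2.
  elim: n r => [|n IH] r rr0.
    have [r_gt0 _] := andP rr0.
    rewrite /K expr0 divr1 mulrAC -cint_cst; apply: le_cint.
    - exact: (cg rr0).
    - exact: cst_continuous.
    - move=> a; have [_ _ _ _ [_ h1 h2]] := small a rr0; rewrite /g.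
      have := ler_normM h1 h1; have := ler_normM h2 h2.
      by rewrite !ler_norml => /andP[? ?] /andP[? ?]; rewrite expr2; lra.
  have := mean_g_bound (K0 n) IH rr0.
  have : 0 <= r ^+ 4 * (pi *+ 2) by rewrite mulr_ge0 ?(ltW pi2)// exprn_even_ge0.
  have : K n * r ^+ 2 = 2 * (K n.+1 * r ^+ 2).
    rewrite /K [2 ^+ n.+1]exprS; field; exact: expf_neq0.
  have : 0 <= K n.+1 * r ^+ 2 by rewrite mulr_ge0 ?sqr_ge0.
  by move: (N r) (K n) (K n.+1) (pi *+ 2) => a b c p; lra.
pose r := r0 / 2.
have rr0 : 0 < r < r0.
  by rewrite /r divr_gt0//= ltr_pdivrMr// ltr_pMr// ltr1n.
have [r_gt0 _] := andP rr0.
have r2_gt0 : 0 < r ^+ 2 by rewrite exprn_gt0.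
(* At a fixed radius, dropping [N r >= 0] from [mean_g_bound] bounds [2 ^+ n] independently of
   [n]. *)
have small_r n : 7 / 200 * r ^+ 2 * 2 ^+ n <= 25^-1.
  have N0 : 0 <= N r.
    apply: Rintegral_ge0 => a _; rewrite /g -!expr2.
    by rewrite addr_ge0 ?sqr_ge0.
  have bound : 7 / 200 * r ^+ 4 * (pi *+ 2) <= 50^-1 * K n * r ^+ 2.
    by apply: le_trans (mean_g_bound (K0 n) (NK n) rr0); rewrite lerDr mulr_ge0.
  have P_gt0 : 0 < 2 ^+ n :> R by rewrite exprn_gt0.
  rewrite -(ler_pM2r (mulr_gt0 pi2 r2_gt0)).
  have -> : 25^-1 * (pi *+ 2 * r ^+ 2) = 50^-1 * K n * r ^+ 2 * 2 ^+ n.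
    by rewrite /K; field; exact: lt0r_neq0.
  have -> : 7 / 200 * r ^+ 2 * 2 ^+ n * (pi *+ 2 * r ^+ 2) =
    7 / 200 * r ^+ 4 * (pi *+ 2) * 2 ^+ n by ring.
  by rewrite ler_wpM2r// ltW.
have c_gt0 : 0 < 7 / 200 * r ^+ 2 by rewrite mulr_gt0.
pose n := Num.bound (25^-1 / (7 / 200 * r ^+ 2)).
have : 25^-1 / (7 / 200 * r ^+ 2) < n%:R.
  by apply: archi_boundP; rewrite divr_ge0// ltW.
rewrite ltr_pdivrMr// mulrC ltNge; case/negP; apply: le_trans (small_r n).
rewrite ler_wpM2l ?(ltW c_gt0)// -natrX ler_nat ltnW//; exact: ltn_expl.
Qed.

End NoHighOrderDisc.

(** * From a J-holomorphic disc to the estimates on small circles *)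

Section Disc.
Context {R : realType}.
Implicit Types (h hx hy : R * R -> R).

Lemma near_circ (P : set (R * R)) : (\forall z \near (0, 0), P z) ->
  exists2 r0 : R, 0 < r0 < 1 & forall r a, 0 < r < r0 -> P (circ r a).
Proof.
move=> /nbhs_ballP[e /= e0 eP].
exists (Num.min e (2^-1)).
  by rewrite lt_min e0 /= invr_gt0 ltr0n/= gt_min invf_lt1// ltr1n orbT.
move=> r a /andP[r0]; rewrite lt_min => /andP[re _]; apply: eP.
by split; rewrite /ball/= sub0r normrN normrM gtr0_norm//;
  apply: le_lt_trans re; rewrite ler_piMr ?(ltW r0)// ?cos_max ?sin_max.
Qed.

(** The first-order expansion at the origin, with the little-o made explicit. *)
Lemma near_linear h hx hy (p q e : R) : has_partials h hx hy ->
  h (0, 0) = 0 -> hx (0, 0) = p -> hy (0, 0) = q -> 0 < e ->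
  \forall z \near (0, 0), `|h z - (z.1 * p + z.2 * q)| <= e * `|z|.
Proof.
move=> hh h0 <- <- e0.
have ud0 : unit_disc (0 : R * R).
  by rewrite /unit_disc/= /modulus/= expr0n/= addr0 sqrtr0 ltr01.
have [dh _ _ _ _] := hh _ ud0.
have /eqaddoP/(_ _ e0) := diff_locally dh.
apply: filterS => z /=.
rewrite !fctE /= addr0 (diff_partials _ hh ud0) -[0 : R * R]/(0, 0) h0 add0r.
exact.
Qed.

Lemma near_close h (p e : R) : {for 0, continuous h} -> h (0, 0) = p -> 0 < e ->
  \forall z \near (0, 0), `|h z - p| <= e.
Proof.
move=> /cvgrPdist_le ch <- e0; have := ch _ e0.
by apply: filterS => z; rewrite distrC.
Qed.

Lemma norm_circ (r a : R) : 0 < r -> `|circ r a| <= r.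
Proof.
move=> r0; rewrite prod_normE/= ge_max !normrM gtr0_norm//.
by rewrite !ler_piMr ?(ltW r0)// ?cos_max ?sin_max.
Qed.

Lemma has_partials_entry n (g : R * R -> 'cV[R]_n) i : C1_on (@unit_disc R) g ->
  has_partials (fun z => g z i 0) (fun z => 'd g z (1, 0) i 0)
               (fun z => 'd g z (0, 1) i 0).
Proof.
move=> Cg z /Cg[dg dgc]; split.
- exact: differentiable_entry.
- exact: diff_entry_comp.
- exact: diff_entry_comp.
- apply: (@continuous_comp _ _ _ (fun z => 'd g z (1, 0)) (fun N => N i 0)).
    exact: dgc.
  exact: coord_continuous.
- apply: (@continuous_comp _ _ _ (fun z => 'd g z (0, 1)) (fun N => N i 0)).
    exact: dgc.
  exact: coord_continuous.
Qed.

(** The hypotheses of [no_high_order_disc] are met on small circles: first-order expansions control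
    [z1] and [z2], continuity controls [f'], and the order of tangency controls [t]. *)
Lemma no_disc : ~ exists g : R * R -> 'cV[R]_6,
  [/\ Jholomorphic_disc Jex g, g 0 = 0, 'D_(1, 0) g 0 = vec6 1 0 0 0 0 0 &
      exists k : nat, (5 < k)%N /\ tangent_at_order phiex g k].
Proof.
have quarter (r : R) : 0 < r -> 100^-1 / 4 * r <= r by move=> ?; lra.
have hundredth (r C : R) : r * (100 * C) <= 1 -> C * r <= 100^-1 by move=> ?; lra.
move=> [g [[Cg Jg] g0 gv [k [k5 gk]]]].
have ud0 : unit_disc (0 : R * R).
  by rewrite /unit_disc/= /modulus/= expr0n/= addr0 sqrtr0 ltr01.
have D i := has_partials_entry i Cg.
have CR z : unit_disc z -> forall i,
    'd g z (0, 1) i 0 = (Jex (g z) *m 'd g z (1, 0)) i 0.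
  by move=> /Jg/(_ (1, 0)) <-; rewrite /J0/= oppr0.
have dg0 i : 'd g (0, 0) (1, 0) i 0 = (vec6 1 0 0 0 0 0 : 'cV[R]_6) i 0.
  by rewrite -[(0, 0)]/(0 : R * R) -gv deriveE//; have [] := Cg _ ud0.
(* J-holomorphy determines the other partial derivative from [v], so that [z1 = zeta + o(zeta)] and
   [z2 = o(zeta)]. *)
have dg0y i : 'd g (0, 0) (0, 1) i 0 = (Jex 0 *m (vec6 1 0 0 0 0 0 : 'cV[R]_6)) i 0.
  rewrite -[(0, 0)]/(0 : R * R) CR// g0; congr ((_ *m _) i 0).
  by apply/colP => j; exact: dg0.
have g0i i : g (0, 0) i 0 = 0 by rewrite -[(0, 0)]/(0 : R * R) g0 mxE.
have e0 : 0 < (100^-1 / 4) :> R by lra.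
have [X0 X1 X2 X3] : [/\ 'd g (0, 0) (1, 0) i0 0 = 1, 'd g (0, 0) (1, 0) i1 0 = 0,
    'd g (0, 0) (1, 0) i2 0 = 0 & 'd g (0, 0) (1, 0) i3 0 = 0].
  by split; rewrite dg0 mxE.
have [Y0 Y1 Y2 Y3] : [/\ 'd g (0, 0) (0, 1) i0 0 = 0, 'd g (0, 0) (0, 1) i1 0 = 1,
    'd g (0, 0) (0, 1) i2 0 = 0 & 'd g (0, 0) (0, 1) i3 0 = 0].
  by split; rewrite dg0y Jex_mulE/= !mxE/=; ring.
have n0 := near_linear (D i0) (g0i i0) X0 Y0 e0.
have n1 := near_linear (D i1) (g0i i1) X1 Y1 e0.
have n2 := near_linear (D i2) (g0i i2) X2 Y2 e0.
have n3 := near_linear (D i3) (g0i i3) X3 Y3 e0.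
have [_ _ _ c0 _] := D i0 _ ud0; have [_ _ _ c1 _] := D i1 _ ud0.
have m0 := near_close c0 X0 e0; have m1 := near_close c1 X1 e0.
move: gk => /eqO_exP[C C0 gC].
have [r1 /andP[r1_gt0 r1_lt1] Hr] := near_circ
  (filterI (filterI (filterI n0 n1) (filterI n2 n3)) (filterI (filterI m0 m1) gC)).
have C100 : 0 < (100 * C)^-1 by rewrite invr_gt0 mulr_gt0.
(* The second radius ensures [C * r <= 100^-1]. *)
pose r0 := Num.min r1 (100 * C)^-1.
have r0_gt0 : 0 < r0 by rewrite lt_min r1_gt0.
have r0_lt1 : r0 < 1 by rewrite gt_min r1_lt1.
apply: (no_high_order_disc (D i0) (D i1) (D i2) (D i3) (D i4) (D i5) _ r0_gt0 r0_lt1).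
- move=> z /CR dy; rewrite !dy !Jex_mulE/=; split; [ring|ring|ring|ring|].
  by split; ring.
- by split; exact: g0i.
move=> r a /andP[r_gt0]; rewrite lt_min => /andP[rr1 rC].
have rr : 0 < r < r1 by rewrite r_gt0.
have [[[h0 h1] [h2 h3]] [[h4 h5] h6]] := Hr r a rr.
have nc := ler_wpM2l (ltW e0) (norm_circ a r_gt0).
rewrite mulr1 mulr0 addr0 in h0; rewrite mulr1 mulr0 add0r in h1.
rewrite subr0 in h5.
rewrite !mulr0 addr0 subr0 in h2; rewrite !mulr0 addr0 subr0 in h3.
have h0' : `|g (circ r a) i0 0 - r * cos a| <= (100^-1 / 4) * r.
  exact: le_trans h0 nc.
have h1' : `|g (circ r a) i1 0 - r * sin a| <= (100^-1 / 4) * r.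
  exact: le_trans h1 nc.
have h2' : `|g (circ r a) i2 0| <= r.
  exact: le_trans (le_trans h2 nc) (quarter r r_gt0).
have h3' : `|g (circ r a) i3 0| <= r.
  exact: le_trans (le_trans h3 nc) (quarter r r_gt0).
split=> //; split=> //.
apply: le_trans h6 _; rewrite modulus_circ normrX normr_id gtr0_norm//.
have r_le1 : r <= 1 by rewrite ltW// (lt_trans rr1).
(* One factor [r] compensates [C], four give the required [r ^+ 4], and the remaining power is at
   most [1]. *)
have -> : r ^+ k = r ^+ 4 * r * r ^+ (k - 5).
  by rewrite -exprSr -exprD subnKC// ltnW.
have -> : C * (r ^+ 4 * r * r ^+ (k - 5)) = C * r * r ^+ (k - 5) * r ^+ 4 by ring.
apply: ler_wpM2r; first by rewrite exprn_ge0// ltW.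
rewrite -[leRHS]mulr1; apply: ler_pM.
- by rewrite mulr_ge0// ltW.
- by rewrite exprn_ge0// ltW.
- by apply: hundredth; rewrite -ler_pdivlMr ?mulr_gt0// div1r ltW.
- by rewrite exprn_ile1// ltW.
Qed.

End Disc.

Theorem theorem1p1 (R : realType) :
  exists (J : 'cV[R]_6 -> 'M[R]_6) (phi : 'cV[R]_6 -> R) (v : 'cV[R]_6),
    [/\ analytic_almost_complex J,
        analytic_hypersurface phi /\ zeros phi 0,
        complex_line_subbundle J phi (levi_ker J phi),
        levi_ker J phi 0 v &
        ~ exists g : R * R -> 'cV[R]_6,
            [/\ Jholomorphic_disc J g, g 0 = 0, 'D_(1, 0) g 0 = v &
                exists k : nat, (5 < k)%N /\ tangent_at_order phi g k]].
Proof.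
exists Jex, phiex, (vec6 1 0 0 0 0 0); split.
- exact: Jex_analytic.
- by split; [exact: phiex_hypersurface|rewrite /zeros/= /phiex mxE].
- exact: levi_ker_subbundle.
- exact: levi_ker_origin.
- exact: no_disc.
Qed.
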